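(* Let $q,a,b,d$ be nonzero complex numbers with $|q|<1$, such that no zero factor occurs in any denominator below (including the denominators of the terms of the series) and all the series below converge absolutely. Then $$\frac{\left(ab,\frac{q^2}{b};q\right)_\infty\left(q,\frac{q^3}{a},q^2a,a^2;q^2\right)_\infty}{(q^2,a;q)_\infty}$$ $$\times\Bigg[{}_{14}W_{13}\left(q;\frac{q^2}{ab},\frac{q^3}{ab},b,bq,\sqrt{qa},-\sqrt{qa},\sqrt{q^3a},-\sqrt{q^3a},\frac{q^2}{ad},\frac{qd}{a},q^2;\,q^2,\,a^2\right)$$ $$+a^2\,\frac{(1-q^3)\left(1-\frac{q^2}{ab}\right)(1-b)(1-aq)\left(1-\frac{q}{ad}\right)\left(1-\frac{d}{a}\right)}{(1-q)\left(1-\frac{q^2}{b}\right)(1-ab)(1-ad)\left(1-\frac{q^3}{a}\right)\left(1-\frac{aq}{d}\right)}$$ $$\times\;{}_{14}W_{13}\left(q^3;\frac{q^3}{ab},\frac{q^4}{ab},bq,bq^2,\sqrt{q^3a},-\sqrt{q^3a},\sqrt{q^5a},-\sqrt{q^5a},\frac{q^3}{ad},\frac{q^2d}{a},q^2;\,q^2,\,a^2\right)\Bigg]$$ $$=\left(a^2b,bq,\frac{q^3}{ab},\frac{q^2a}{b};q^2\right)_\infty {}_{12}W_{11}\left(a;\frac{q^2}{ab},b,aq,-a,-aq,d,dq,\frac{q}{d},\frac{q^2}{d};\,q^2,\,a^2\right)$$ $$+a\,\frac{(1-aq^2)(1-d)\left(1-\frac{q}{d}\right)(1+a)}{(1-q^2)\left(1-\frac{aq}{d}\right)(1-ad)}\left(qa^2b,b,\frac{q^2}{ab},\frac{q^3a}{b};q^2\right)_\infty$$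 $$\times\;{}_{12}W_{11}\left(aq^2;\frac{q^3}{ab},bq,aq,-aq,-aq^2,dq,dq^2,\frac{q^2}{d},\frac{q^3}{d};\,q^2,\,a^2\right).$$
   Context: Notation: $(x;q)_0=1$, $(x;q)_n=\prod_{j=0}^{n-1}(1-xq^j)$, $(x;q)_\infty=\prod_{j\ge 0}(1-xq^j)$, and $(x_1,\dots,x_m;q)_n=(x_1;q)_n\cdots(x_m;q)_n$ for $n$ a nonnegative integer or $\infty$. The very-well-poised series with base $p$ (here $p=q^2$) is $${}_{r+1}W_{r}(a_1;a_4,\dots,a_{r+1};p,x)=\sum_{n=0}^{\infty}\frac{(a_1,p\sqrt{a_1},-p\sqrt{a_1},a_4,\dots,a_{r+1};p)_n}{(p,\sqrt{a_1},-\sqrt{a_1},\frac{a_1p}{a_4},\dots,\frac{a_1p}{a_{r+1}};p)_n}\,x^n .$$ Square roots denote fixed choices of complex square root; each occurs together with its negative, so the choice is immaterial. *)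

(* Defs.v *)
(* MathComp / MathComp-Analysis; the field of complex numbers is [R[i]] for
   [R : realType]. *)
From HB Require Import structures.
From mathcomp Require Import all_boot all_order all_algebra.
From mathcomp Require Import complex.
From mathcomp Require Import all_classical all_reals all_analysis.
Set Implicit Arguments.
Unset Strict Implicit.
Unset Printing Implicit Defensive.
Import Order.TTheory GRing.Theory Num.Theory numFieldNormedType.Exports.
Local Open Scope classical_set_scope.
Local Open Scope ring_scope.

(* The definitions are stated over a [numClosedFieldType], where the norm
   topology is found by canonical structures and [sqrtC] is a fixed choice of
   square root. *)

Definition qpoch {C : numClosedFieldType} (x q : C) (n : nat) : C :=
  \prod_(j < n) (1 - x * q ^+ j).

Definition qpoch_inf {C : numClosedFieldType} (x q : C) : C :=
  limn (qpoch x q).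

Definition qpochs {C : numClosedFieldType} (xs : seq C) (q : C) (n : nat) : C :=
  \prod_(x <- xs) qpoch x q n.

Definition qpochs_inf {C : numClosedFieldType} (xs : seq C) (q : C) : C :=
  \prod_(x <- xs) qpoch_inf x q.

Definition no_zero_factor {C : numClosedFieldType} (xs : seq C) (q : C) : Prop :=
  forall x, x \in xs -> forall j : nat, 1 - x * q ^+ j != 0.

(* In the very-well-poised series r+1_W_r (a1; a4, ..., a_{r+1}; p, x) the list
   [s] is [:: a4; ...; a_{r+1}], so that r = size s + 2. *)
Definition W_num {C : numClosedFieldType} (a1 : C) (s : seq C) (p : C) : seq C :=
  [:: a1, p * sqrtC a1, - (p * sqrtC a1) & s].

Definition W_den {C : numClosedFieldType} (a1 : C) (s : seq C) (p : C) : seq C :=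
  [:: p, sqrtC a1, - sqrtC a1 & [seq a1 * p / y | y <- s]].

Definition W_term {C : numClosedFieldType} (a1 : C) (s : seq C) (p x : C)
    (n : nat) : C :=
  qpochs (W_num a1 s p) p n / qpochs (W_den a1 s p) p n * x ^+ n.

Definition W {C : numClosedFieldType} (a1 : C) (s : seq C) (p x : C) : C :=
  limn (series (W_term a1 s p x)).

(* [W a1 s p x] is meaningful: no denominator of a term has a zero factor, and
   the series converges absolutely. *)
Definition W_admissible {C : numClosedFieldType} (a1 : C) (s : seq C) (p x : C)
    : Prop :=
  no_zero_factor (W_den a1 s p) p /\
  cvgn [normed series (W_term a1 s p x)].

(* Main.v *)
Require Import Defs.
From HB Require Import structures.
From mathcomp Require Import all_boot all_order all_algebra.
From mathcomp Require Import complex.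
From mathcomp Require Import all_classical all_reals all_analysis.
From mathcomp Require Import ring zify.
Import Order.TTheory GRing.Theory Num.Theory numFieldNormedType.Exports.
Local Open Scope classical_set_scope.
Local Open Scope ring_scope.

(** The identity is a double sum evaluated in two orders.  Put
      K(N, M) = (q)_(N+M) (q/a)_(N-M) / ((q)_(N-M) (aq)_(N+M))   (base q),
    the kernel that defines WP-Bailey pairs relative to a with k = q.  Two
    sums against K are infinite or finite products.

    - Over M <= N, with weights alpha_M(d) (-1)^M, where alpha_M(d) is
      very-well-poised in a with the parameters -a, d, q/d: this is the
      terminating case of the q-analogue of Whipple's 3F2 sum
      ([wp_sum_even], [wp_sum_odd]).
    - Over N >= M, with weights delta_N(b) that are very-well-poised in q with
      the parameters b, q^2/(ab) and the square roots of qa: this is the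
      q-analogue of Watson's 3F2 sum ([watson_summation]), taken at x = q^M.

    Both products involve symbols with base q^2, so their shape depends on the
    parity of N, respectively of M.  In the sum over N of delta_N times the
    first product, the even N give the first series on the left and the odd N
    the second one; in the sum over M of alpha_M times the second product, the
    even and the odd M give the two series on the right ([W_term1] to
    [W_term4]).  Interchanging the summations ([bailey_sum]) gives the theorem.

    Both product evaluations rest on creative telescoping.  The first sum
    satisfies a two-term recurrence from N to N+2, which determines it.  The
    second one satisfies a two-term recurrence from x to q^2 x; iterating it
    drives x to 0, where the q-binomial series is left.  That series does not
    depend on b, so its value can be read off the case b = x = 1, in which the
    q-Watson series has a single term.

    For |a| < 1 everything converges absolutely, with a geometric majorant,
    and Tannery's theorem justifies the limits.  If |a| >= 1, a series with
    argument a^2 can only converge by terminating.  That the first and the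
    third series terminate without a zero in a denominator forces b or
    q^2/(ab) to be q^(-l) ([small_or_terminating]); then the weights delta_N
    vanish for N > l, the double sum is finite, and the terminating case of
    the q-Watson sum, valid for every a, takes over. *)

(** * Finite q-Pochhammer symbols *)

Lemma qpoch0 {C : numClosedFieldType} (x q : C) : qpoch x q 0 = 1.
Proof. by rewrite /qpoch big_ord0. Qed.

Lemma qpochS {C : numClosedFieldType} (x q : C) n :
  qpoch x q n.+1 = qpoch x q n * (1 - x * q ^+ n).
Proof. by rewrite /qpoch big_ord_recr. Qed.

Lemma qpochD {C : numClosedFieldType} (x q : C) m n :
  qpoch x q (m + n) = qpoch x q m * qpoch (x * q ^+ m) q n.
Proof.
elim: n => [|n IHn]; first by rewrite addn0 qpoch0 mulr1.
by rewrite addnS !qpochS IHn exprD !mulrA.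
Qed.

Lemma qpoch1 {C : numClosedFieldType} (x q : C) : qpoch x q 1 = 1 - x.
Proof. by rewrite qpochS qpoch0 mul1r mulr1. Qed.

Lemma qpochSl {C : numClosedFieldType} (x q : C) n :
  qpoch x q n.+1 = (1 - x) * qpoch (x * q) q n.
Proof. by rewrite -add1n qpochD qpoch1 expr1. Qed.

Lemma qpochS2l {C : numClosedFieldType} (x q : C) n :
  qpoch x q n.+2 = (1 - x) * (1 - x * q) * qpoch (x * q ^+ 2) q n.
Proof. by rewrite !qpochSl mulrA -(mulrA x q q). Qed.

Lemma qpoch_split {C : numClosedFieldType} (x q : C) n :
  qpoch x q (n.*2) = qpoch x (q ^+ 2) n * qpoch (x * q) (q ^+ 2) n.
Proof.
elim: n => [|n IHn]; first by rewrite !qpoch0 mulr1.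
rewrite doubleS !qpochS IHn -!exprM -mul2n (exprS q (2 * n)).
set A := qpoch _ _ _; set B := qpoch _ _ _; ring.
Qed.

Lemma qpoch_pm {C : numClosedFieldType} (x q : C) n :
  qpoch x q n * qpoch (- x) q n = qpoch (x ^+ 2) (q ^+ 2) n.
Proof.
elim: n => [|n IHn]; first by rewrite !qpoch0 mulr1.
by rewrite !qpochS -IHn -exprM mulnC exprM; ring.
Qed.

Definition nonvanishing {C : numClosedFieldType} (x q : C) : Prop :=
  forall j, 1 - x * q ^+ j != 0.

Lemma nonvanishing_shift {C : numClosedFieldType} (x q : C) m :
  nonvanishing x q -> nonvanishing (x * q ^+ m) q.
Proof. by move=> h j; rewrite -mulrA -exprD. Qed.

Lemma qpoch_neq0 {C : numClosedFieldType} {x q : C} :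
  nonvanishing x q -> forall n, qpoch x q n != 0.
Proof. by move=> x0 n; apply/prodf_neq0 => j _; exact: x0. Qed.

Lemma qpoch_drop {C : numClosedFieldType} {x q : C} :
  nonvanishing x q -> forall m n,
  qpoch (x * q ^+ m) q n = qpoch x q (m + n) / qpoch x q m.
Proof. by move=> h m n; rewrite qpochD mulrAC mulfV ?mul1r ?qpoch_neq0. Qed.

Lemma sub_neq0_div (F : fieldType) (b u : F) :
  b != 0 -> 1 - u / b != 0 -> b - u != 0.
Proof.
move=> b0 h; rewrite (_ : b - u = b * (1 - u / b)); last by field.
by rewrite mulf_neq0.
Qed.

(** Identities between products of q-Pochhammer symbols are checked symbol by
    symbol: once each symbol and each linear factor is a variable, the ring
    normalization no longer expands them into huge polynomials. *)
Ltac atoms := repeat match goal with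
  | |- context [qpoch ?u ?v ?n] => move: (qpoch u v n) => ?
  | |- context [qpoch_inf ?u ?v] => move: (qpoch_inf u v) => ?
  | |- context [1 - ?u] => move: (1 - u) => ? end.

(** The inverses of factors not known to be nonzero occur on both sides and are
    variables as well, so that only genuine cancellations need a hypothesis. *)
Ltac field_atoms := rewrite ?mulr1; atoms; intros; rewrite ?invfM;
  repeat match goal with |- context [?u ^-1] =>
    lazymatch goal with
    | H : is_true (u != 0) |- _ => fail
    | _ => move: (u^-1) => ? end end;
  field; repeat (apply/andP; split => //).

(** * The terminating q-analogue of Whipple's 3F2 sum *)

Definition wp_kernel {C : numClosedFieldType} (q a : C) (N M : nat) : C :=
  qpoch q q (N + M) * qpoch (q / a) q (N - M)
  / (qpoch q q (N - M) * qpoch (a * q) q (N + M)).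

Definition wp_alpha {C : numClosedFieldType} (q a d : C) (M : nat) : C :=
  (1 - a * q ^+ (2 * M)) / (1 - a)
  * (qpoch (a ^+ 2) (q ^+ 2) M * qpoch d q M * qpoch (q / d) q M)
  / (qpoch (q ^+ 2) (q ^+ 2) M * qpoch (a * d) q M * qpoch (a * q / d) q M).

(** Certificate of the recurrence from N to N+2 (creative telescoping).  The
    factor 1 - q^(2M) makes it vanish at the lower end of the sum. *)
Definition wp_cert {C : numClosedFieldType} (q a d : C) (N M : nat) : C :=
  q ^+ N * q ^+ 2 * (1 - q ^+ (2 * N + 3)) / a
  * (1 - q ^+ (2 * M)) * (1 - a * d * q ^+ M / q) * (1 - a / d * q ^+ M)
  / q ^+ M * (-1) ^+ M
  * (qpoch (a ^+ 2) (q ^+ 2) M * qpoch d q M * qpoch (q / d) q M)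
  / (qpoch (q ^+ 2) (q ^+ 2) M * qpoch (a * d) q M * qpoch (a * q / d) q M)
  * (qpoch q q (N + M) * qpoch (q / a) q (N.+1 - M)
     / (qpoch q q (N.+2 - M) * qpoch (a * q) q (N.+1 + M))).

Section Whipple.
Context {C : numClosedFieldType}.
Variables (q a d : C).
Hypotheses (q0 : q != 0) (a0 : a != 0) (d0 : d != 0).
Hypothesis (qn : nonvanishing q q).
Hypothesis (q2n : nonvanishing (q ^+ 2) (q ^+ 2)).
Hypothesis (an : nonvanishing a q).
Hypothesis (adn : nonvanishing (a * d) q).
Hypothesis (aqdn : nonvanishing (a * q / d) q).

Let anq : nonvanishing (a * q) q. Proof. exact: (nonvanishing_shift _ _ 1). Qed.

Let an0 : 1 - a != 0.
Proof. by have := an 0%N; rewrite expr0 mulr1. Qed.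

Lemma wp_step N m : (m <= N)%N ->
  (1 - a * d * q ^+ N.+1) * (1 - a * q ^+ N.+2 / d)
    * (wp_alpha q a d m * (-1) ^+ m * wp_kernel q a N.+2 m)
  - (1 - q ^+ N.+2 / (a * d)) * (1 - d * q ^+ N.+1 / a)
    * (wp_alpha q a d m * (-1) ^+ m * wp_kernel q a N m)
  = wp_cert q a d N m.+1 - wp_cert q a d N m.
Proof.
move=> mN; rewrite -(subnKC mN); set k := (N - m)%N.
rewrite /wp_cert /wp_alpha /wp_kernel.
rewrite !(addSn, addnS) !subSS.
have -> : ((m + k).+2 - m = k.+2)%N by lia.
have -> : ((m + k).+1 - m = k.+1)%N by lia.
have -> : (m + k - m = k)%N by lia.
have E2 j : q ^+ (2 * j) = (q ^+ j) ^+ 2 by rewrite mulnC exprM.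
have E2' j : (q ^+ 2) ^+ j = (q ^+ j) ^+ 2 by rewrite exprAC.
have := an0.
have := qpoch_neq0 q2n m.
have := qpoch_neq0 adn m.
have := qpoch_neq0 aqdn m.
have := qpoch_neq0 qn k.
have := qpoch_neq0 anq (m + k + m).
have := aqdn m; have := adn m; have := q2n m.
have := qn k; have := qn k.+1.
have := anq (m + k + m)%N; have := anq (m + k + m).+1.
have : q ^+ m != 0 by rewrite expf_neq0.
rewrite ?addn0 !qpochS !(exprS q (2 * _).+2) !(exprS q (2 * _).+1).
rewrite !(exprS q (2 * _)) !E2 !E2' !(exprS, exprD) ?expr0 ?mulr1.
(* With x = q^m and z = q^(N-m) this is an identity of rational functions. *)
move: (q ^+ m) (q ^+ k) => x z x0 h1 h2 h3 h4 h5 h6 h7 g1 g2 g3 g4 g5 g6.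
field.
repeat (apply/andP; split => //).
have -> : d - a * q * x = d * (1 - a * q / d * x) by field.
by rewrite mulf_neq0.
Qed.

(** The indices M = N+1 and M = N+2 occur only in the longer of the two sums;
    their terms cancel the certificate at the upper end. *)
Lemma wp_last N :
  (1 - a * d * q ^+ N.+1) * (1 - a * q ^+ N.+2 / d)
    * (wp_alpha q a d N.+1 * (-1) ^+ N.+1 * wp_kernel q a N.+2 N.+1
       + wp_alpha q a d N.+2 * (-1) ^+ N.+2 * wp_kernel q a N.+2 N.+2)
  = - wp_cert q a d N N.+1.
Proof.
rewrite /wp_cert /wp_alpha /wp_kernel.
rewrite !(addSn, addnS) !subSS subnn (_ : N.+1 - N = 1)%N; last by lia.
have E2 j : q ^+ (2 * j) = (q ^+ j) ^+ 2 by rewrite mulnC exprM.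
have E2' j : (q ^+ 2) ^+ j = (q ^+ j) ^+ 2 by rewrite exprAC.
have := an0.
have := qpoch_neq0 q2n N.
have := qpoch_neq0 adn N.
have := qpoch_neq0 aqdn N.
have := qpoch_neq0 anq (N + N).
have := aqdn N.+1; have := adn N.+1; have := q2n N.+1.
have := aqdn N; have := adn N; have := q2n N.
have := qn 0%N; have := qn 1%N.
have := anq (N + N)%N; have := anq (N + N).+1.
have := anq (N + N).+2; have := anq (N + N).+3.
have : q ^+ N != 0 by rewrite expf_neq0.
rewrite ?addn0 !qpochS ?qpoch0 !(exprS q (2 * _).+2) !(exprS q (2 * _).+1).
rewrite !(exprS q (2 * _)) !E2 !E2' !(exprS, exprD) ?expr0 ?mulr1.
move: (q ^+ N) => x x0.
move=> h1 h2 h3 h4 h5 h6 h7 h8 h9 h10 h11 h12 g1 g3 g4 g5 g6.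
have dq u : 1 - a * q / d * u != 0 -> d - a * q * u != 0.
  move=> h; rewrite (_ : _ - _ = d * (1 - a * q / d * u)); last by field.
  by rewrite mulf_neq0.
have d1 := dq _ h9; have d2 := dq _ h12.
field.
repeat (apply/andP; split => //).
Qed.

Lemma wp_rec N :
  (1 - a * d * q ^+ N.+1) * (1 - a * q ^+ N.+2 / d)
    * (\sum_(M < N.+3) wp_alpha q a d M * (-1) ^+ M * wp_kernel q a N.+2 M)
  = (1 - q ^+ N.+2 / (a * d)) * (1 - d * q ^+ N.+1 / a)
    * (\sum_(M < N.+1) wp_alpha q a d M * (-1) ^+ M * wp_kernel q a N M).
Proof.
apply/eqP; rewrite -subr_eq0 2!big_ord_recr /= -addrA mulrDr wp_last.
rewrite addrAC subr_eq0 !mulr_sumr -sumrB.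
have -> : wp_cert q a d N N.+1 = wp_cert q a d N N.+1 - wp_cert q a d N 0.
  by rewrite {3}/wp_cert muln0 expr0 subrr mulr0 !mul0r subr0.
rewrite -(telescope_sumr (wp_cert q a d N) (leq0n N.+1)) big_mkord.
by apply/eqP/eq_bigr => i _; apply: wp_step; rewrite -ltnS ltn_ord.
Qed.

Let rec_den N : (1 - a * d * q ^+ N.+1) * (1 - a * q ^+ N.+2 / d) != 0.
Proof.
rewrite mulf_neq0 //; have := aqdn N.+1.
by rewrite (_ : a * q / d * _ = a * q ^+ N.+2 / d) // [in RHS]exprS; field.
Qed.

Let adn_sqr i j : 1 - a * d * q ^+ i * (q ^+ 2) ^+ j != 0.
Proof. by rewrite -mulrA -exprM -exprD. Qed.

Let aqdn_sqr i j : 1 - a * q ^+ i.+1 / d * (q ^+ 2) ^+ j != 0.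
Proof.
rewrite (_ : _ * _ = a * q / d * q ^+ (i + 2 * j)) //.
by rewrite exprS exprD exprM; field.
Qed.

(** The recurrence has order two but relates only N and N+2, so that the even
    and the odd sums are separate products. *)
Lemma wp_sum_even n :
  \sum_(M < n.*2.+1) wp_alpha q a d M * (-1) ^+ M * wp_kernel q a n.*2 M
  = qpoch (q ^+ 2 / (a * d)) (q ^+ 2) n * qpoch (q * d / a) (q ^+ 2) n
    / (qpoch (q * a * d) (q ^+ 2) n * qpoch (q ^+ 2 * a / d) (q ^+ 2) n).
Proof.
elim: n => [|n IHn].
  rewrite big_ord1 /wp_alpha /wp_kernel /= !qpoch0 !expr0.
  by field; exact: an0.
apply: (mulfI (rec_den n.*2)); rewrite doubleS wp_rec IHn !qpochS.
have E1 : q * a * d = a * d * q ^+ 1 by ring.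
have E2 : q ^+ 2 * a / d = a * q ^+ 2 / d by field.
have := qpoch_neq0 (adn_sqr 1) n; have := qpoch_neq0 (aqdn_sqr 1) n.
have := adn_sqr 1 n; have := aqdn_sqr 1 n; rewrite -E1 -E2.
have E3 j : (q ^+ 2) ^+ j = q ^+ j.*2 by rewrite -exprM mul2n.
rewrite !E3; move: (n.*2) => m; rewrite !exprS expr0 mulr1.
move: (q ^+ m) => x h1 h2 D1 D2.
field; repeat (apply/andP; split => //).
have -> : d - q * q * a * x = d * (1 - q * q * a / d * x) by field.
by rewrite mulf_neq0.
Qed.

Lemma wp_sum_odd n :
  \sum_(M < n.*2.+2) wp_alpha q a d M * (-1) ^+ M * wp_kernel q a n.*2.+1 M
  = - a * (qpoch (q / (a * d)) (q ^+ 2) n.+1 * qpoch (d / a) (q ^+ 2) n.+1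
    / (qpoch (a * d) (q ^+ 2) n.+1 * qpoch (a * q / d) (q ^+ 2) n.+1)).
Proof.
have dq u : 1 - a * q / d * u != 0 -> d - a * q * u != 0.
  move=> h; rewrite (_ : _ - _ = d * (1 - a * q / d * u)); last by field.
  by rewrite mulf_neq0.
elim: n => [|n IHn].
  rewrite big_ord_recr big_ord1 /wp_alpha /wp_kernel /= !(qpochS, qpoch0) !expr0.
  rewrite !mulr1 !mul1r !muln1 !expr1.
  have := aqdn 0%N; have := aqdn 1%N; have := adn 0%N; have := adn 1%N; have := an0.
  have := anq 0%N; have := anq 1%N; have := qn 0%N; have := qn 1%N; have := q2n 0%N.
  rewrite !expr0 !expr1 !mulr1 => h1 h2 h3 h4 h5 h6 h7 h8 h9 h10.
  have := dq 1; rewrite !mulr1 => /(_ h10) h11.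
  by field; repeat (apply/andP; split => //).
apply: (mulfI (rec_den n.*2.+1)).
rewrite doubleS wp_rec IHn [qpoch _ _ n.+2]qpochS [qpoch (d / a) _ n.+2]qpochS.
rewrite [qpoch (a * d) _ n.+2]qpochS [qpoch (a * q / d) _ n.+2]qpochS.
have D1 := qpoch_neq0 (adn_sqr 0) n.+1.
have D2 := qpoch_neq0 (aqdn_sqr 0) n.+1.
have := adn_sqr 0 n.+1; have := aqdn_sqr 0 n.+1; move: D1 D2.
have E2' j : (q ^+ 2) ^+ j.+1 = q * q * q ^+ j.*2.
  by rewrite -exprM mul2n doubleS !exprS mulrA.
rewrite !E2'; move: (n.*2) => m; rewrite !exprS !expr0 !mulr1.
move: (q ^+ m) => x D1 D2 h1 h2.
field; repeat (apply/andP; split => //).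
exact: dq.
Qed.

End Whipple.

(** * The recurrence behind the q-analogue of Watson's 3F2 sum *)

(** The very-well-poised terms with lambda = q x^2 and the parameters q/a,
    q^2 x/(ab), b x and the two square roots of q a x^2, multiplied by
    1 - lambda.  Every parameter but q/a is a multiple of x, which makes x the
    variable to move. *)
Definition watson_term {C : numClosedFieldType} (q a b x : C) (k : nat) : C :=
  (1 - q * x ^+ 2 * q ^+ (2 * k))
  * (qpoch (q * x ^+ 2) q k * qpoch (q / a) q k * qpoch (q ^+ 2 * x / (a * b)) q k
     * qpoch (b * x) q k * qpoch (q * a * x ^+ 2) (q ^+ 2) k) * (- a) ^+ k
  / (qpoch q q k * qpoch (a * q * x ^+ 2) q k * qpoch (a * b * x) q k
     * qpoch (q ^+ 2 * x / b) q k * qpoch (q ^+ 3 * x ^+ 2 / a) (q ^+ 2) k).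

(** The product evaluation at x divided by the one at q^2 x. *)
Definition watson_ratio {C : numClosedFieldType} (q a b x : C) : C :=
  qpoch (q * x ^+ 2) q 4
  * ((1 - b * q * x) * (1 - q ^+ 3 * x / (a * b)) * (1 - a * q ^+ 2 * x / b)
     * (1 - a ^+ 2 * b * x))
  / (qpoch (a * b * x) q 2 * qpoch (q ^+ 2 * x / b) q 2
     * qpoch (q ^+ 3 * x ^+ 2 / a) (q ^+ 2) 2
     * qpoch (a * q ^+ 2 * x ^+ 2) (q ^+ 2) 2).

(** Error term of the recurrence for partial sums.  It contains a^n and, if
    b x = q^(-m) with m > 0, a symbol that vanishes for large n: these are the
    two ways in which it disappears in the limit. *)
Definition watson_rem {C : numClosedFieldType} (q a b x : C) (n : nat) : C :=
  (1 - a) * (1 - a * q ^+ 2 * x ^+ 2) * (- a) ^+ n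
  * (qpoch (q * x ^+ 2) q n.+2 * qpoch (q / a) q n
     * qpoch (q ^+ 3 * x / (a * b)) q n.+1 * qpoch (b * q * x) q n.+1
     * qpoch (q * a * x ^+ 2) (q ^+ 2) n.+2)
  / (qpoch q q n.+1 * qpoch (a * q * x ^+ 2) q n.+3 * qpoch (a * b * x) q n.+1
     * qpoch (q ^+ 2 * x / b) q n.+1
     * qpoch (q ^+ 3 * x ^+ 2 / a) (q ^+ 2) n.+1).

Section WatsonRecurrence.
Context {C : numClosedFieldType}.
Variables (q a b x : C).
Hypotheses (q0 : q != 0) (a0 : a != 0) (b0 : b != 0).
Hypothesis (qn : nonvanishing q q).
Hypothesis (hx : nonvanishing (q * x ^+ 2) q).
Hypothesis (hax : nonvanishing (a * q * x ^+ 2) q).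
Hypothesis (habx : nonvanishing (a * b * x) q).
Hypothesis (hxb : nonvanishing (q ^+ 2 * x / b) q).
Hypothesis (hxa : nonvanishing (q ^+ 3 * x ^+ 2 / a) (q ^+ 2)).

Lemma watson_rec0 :
  watson_term q a b x 0 + watson_term q a b x 1 = watson_rem q a b x 0.
Proof.
rewrite /watson_term /watson_rem !qpochS !qpoch0.
have := qn 0%N; have := hx 0%N; have := hx 1%N; have := hax 0%N; have := hax 1%N.
have := hax 2%N; have := habx 0%N; have := hxb 0%N; have := hxa 0%N.
have := hx 2%N.
rewrite !exprS !expr0 !mulr1 => h1 h2 h3 h4 h5 h6 h7 h8 h9 h10.
by field; repeat (apply/andP; split => //); exact: sub_neq0_div.
Qed.

(** The common factor of all terms of [watson_step]: dividing by it leaves a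
    rational identity of low degree. *)
Let V n := (- a) ^+ n
  * (qpoch (q * x ^+ 2) q n.+2 * qpoch (q / a) q n
     * qpoch (q ^+ 3 * x / (a * b)) q n.+1 * qpoch (b * q * x) q n.+1
     * qpoch (q * a * x ^+ 2) (q ^+ 2) n.+2)
  / (qpoch q q n.+1 * qpoch (a * q * x ^+ 2) q n.+3 * qpoch (a * b * x) q n.+1
     * qpoch (q ^+ 2 * x / b) q n.+1
     * qpoch (q ^+ 3 * x ^+ 2 / a) (q ^+ 2) n.+1).

Let term_split n : watson_term q a b x n.+2 =
  V n * ((1 - q * x ^+ 2 * q ^+ (2 * n.+2)) * a ^+ 2
   * (1 - q / a * q ^+ n) * (1 - q / a * q ^+ n.+1)
   * (1 - q ^+ 2 * x / (a * b)) * (1 - b * x) * (1 - a * q * x ^+ 2 * q ^+ n.+2)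
   / ((1 - q * q ^+ n.+1) * (1 - a * b * x * q ^+ n.+1)
      * (1 - q ^+ 2 * x / b * q ^+ n.+1)
      * (1 - q ^+ 3 * x ^+ 2 / a * (q ^+ 2) ^+ n.+1))).
Proof.
rewrite /watson_term /V.
rewrite [qpoch (b * x) _ _]qpochSl [qpoch (_ ^+ 2 * x / (a * b)) _ _]qpochSl.
have -> : q ^+ 3 * x / (a * b) = q ^+ 2 * x / (a * b) * q by ring.
have -> : b * q * x = b * x * q by ring.
rewrite (qpochS q q n.+1) (qpochS (a * q * x ^+ 2) q n.+2).
rewrite (qpochS (a * b * x) q n.+1) (qpochS (_ / b) q n.+1).
rewrite (qpochS (_ / a) (q ^+ 2) n.+1) (qpochS (_ / a) q n.+1).
rewrite (qpochS (_ / a) q n) (_ : (- a) ^+ n.+2 = (- a) ^+ n * a ^+ 2); last first.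
  by rewrite !exprS; ring.
have := qpoch_neq0 qn n.+1; have := qn n.+1.
have := qpoch_neq0 hax n.+2; have := hax n.+2.
have := qpoch_neq0 habx n.+1; have := habx n.+1.
have := qpoch_neq0 hxb n.+1; have := hxb n.+1.
have := qpoch_neq0 hxa n.+1; have := hxa n.+1.
move: ((- a) ^+ n) (a ^+ 2) => s1 s2.
atoms.
move=> *.
field.
by repeat (apply/andP; split => //).
Qed.

Let shift_split n : watson_ratio q a b x * watson_term q a b (q ^+ 2 * x) n =
  V n * ((1 - q * x ^+ 2 * q ^+ 4 * q ^+ (2 * n)) * (1 - a * q ^+ 2 * x / b)
   * (1 - a ^+ 2 * b * x)
   * (1 - q * x ^+ 2 * q ^+ n.+2) * (1 - q * x ^+ 2 * q ^+ n.+3)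
   * (1 - q * q ^+ n)
   / ((1 - a * q * x ^+ 2 * q ^+ n.+3) * (1 - a * b * x * q ^+ n.+1)
      * (1 - q ^+ 2 * x / b * q ^+ n.+1)
      * (1 - q ^+ 3 * x ^+ 2 / a * (q ^+ 2) ^+ n.+1))).
Proof.
rewrite /watson_term /V /watson_ratio.
have -> : q * (q ^+ 2 * x) ^+ 2 = q * x ^+ 2 * q ^+ 4 by ring.
have -> : a * q * (q ^+ 2 * x) ^+ 2 = a * q * x ^+ 2 * q ^+ 4 by ring.
have -> : q ^+ 2 * (q ^+ 2 * x) / (a * b) = q ^+ 3 * x / (a * b) * q by ring.
have -> : b * (q ^+ 2 * x) = b * q * x * q by ring.
have -> : a * b * (q ^+ 2 * x) = a * b * x * q ^+ 2 by ring.
have -> : q ^+ 2 * (q ^+ 2 * x) / b = q ^+ 2 * x / b * q ^+ 2 by ring.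
have -> : q * a * (q ^+ 2 * x) ^+ 2 = q * a * x ^+ 2 * (q ^+ 2) ^+ 2 by ring.
have -> : q ^+ 3 * (q ^+ 2 * x) ^+ 2 / a = q ^+ 3 * x ^+ 2 / a * (q ^+ 2) ^+ 2 by ring.
rewrite !(qpoch_drop hx, qpoch_drop hax).
rewrite !(qpoch_drop habx, qpoch_drop hxb).
rewrite !(qpoch_drop hxa) !addSn !add0n.
rewrite (qpochSl (b * q * x)) (qpochSl (_ / (a * b))) (qpochS2l (q * a * _)).
rewrite (qpochS (_ * _ ^+ 2) q n.+3) (qpochS (_ * _ ^+ 2) q n.+2).
rewrite (qpochS (a * q * _ ^+ 2) q n.+3) (qpochS q q n).
rewrite (qpochS (a * b * x) q n.+1) (qpochS (_ / b) q n.+1).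
rewrite (qpochS (_ / a) (q ^+ 2) n.+1).
have := qpoch_neq0 qn n; have := qn n.
have := qpoch_neq0 hx n.+2; have := qpoch_neq0 hx 4.
have := qpoch_neq0 hax n.+3; have := qpoch_neq0 hax 4; have := hax n.+3.
have := qpoch_neq0 habx n.+1; have := qpoch_neq0 habx 2; have := habx n.+1.
have := qpoch_neq0 hxb n.+1; have := qpoch_neq0 hxb 2; have := hxb n.+1.
have := qpoch_neq0 hxa n.+1; have := qpoch_neq0 hxa 2; have := hxa n.+1.
have -> : qpoch (a * q * x ^+ 2) q 4
  = (1 - q * a * x ^+ 2) * (1 - q * a * x ^+ 2 * q ^+ 2)
    * qpoch (a * q ^+ 2 * x ^+ 2) (q ^+ 2) 2.
  by rewrite !qpochS !qpoch0; ring.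
move: ((- a) ^+ n) => s.
atoms.
do 10 intro; rewrite !mulf_eq0 !negb_or.
case/andP=> /andP[? ?] ?; move=> *.
field.
by repeat (apply/andP; split => //).
Qed.

Let rem_split n : watson_rem q a b x n = V n * ((1 - a) * (1 - a * q ^+ 2 * x ^+ 2)).
Proof. by rewrite /watson_rem /V; ring. Qed.

Let remS_split n : watson_rem q a b x n.+1 =
  V n * ((1 - a) * (1 - a * q ^+ 2 * x ^+ 2) * - a
   * (1 - q * x ^+ 2 * q ^+ n.+2) * (1 - q / a * q ^+ n)
   * (1 - q ^+ 3 * x / (a * b) * q ^+ n.+1) * (1 - b * q * x * q ^+ n.+1)
   * (1 - q * a * x ^+ 2 * (q ^+ 2) ^+ n.+2)
   / ((1 - q * q ^+ n.+1) * (1 - a * q * x ^+ 2 * q ^+ n.+3)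
      * (1 - a * b * x * q ^+ n.+1) * (1 - q ^+ 2 * x / b * q ^+ n.+1)
      * (1 - q ^+ 3 * x ^+ 2 / a * (q ^+ 2) ^+ n.+1))).
Proof.
rewrite /watson_rem /V (qpochS (q * x ^+ 2) q n.+2) (qpochS (q / a) q n).
rewrite (qpochS (b * q * x) q n.+1) (qpochS (_ / (a * b)) q n.+1).
rewrite (qpochS (q * a * _) (q ^+ 2) n.+2) (qpochS q q n.+1).
rewrite (qpochS (a * q * _) q n.+3) (qpochS (a * b * x) q n.+1).
rewrite (qpochS (_ / b) q n.+1) (qpochS (_ / a) (q ^+ 2) n.+1) (exprS (- a) n).
have := qpoch_neq0 qn n.+1; have := qn n.+1.
have := qpoch_neq0 hax n.+3; have := hax n.+3.
have := qpoch_neq0 habx n.+1; have := habx n.+1.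
have := qpoch_neq0 hxb n.+1; have := hxb n.+1.
have := qpoch_neq0 hxa n.+1; have := hxa n.+1.
move: ((- a) ^+ n) => s.
atoms.
move=> *.
by field; repeat (apply/andP; split => //).
Qed.

Lemma watson_step n :
  watson_term q a b x n.+2
    - watson_ratio q a b x * watson_term q a b (q ^+ 2 * x) n
  = watson_rem q a b x n.+1 - watson_rem q a b x n.
Proof.
rewrite term_split shift_split remS_split rem_split -!mulrBr; congr (_ * _).
have := qn n.+1; have := hax n.+3; have := habx n.+1; have := hxb n.+1.
have := hxa n.+1.
have E2 j : q ^+ (2 * j) = (q ^+ j) ^+ 2 by rewrite mulnC exprM.
have E2' j : (q ^+ 2) ^+ j = (q ^+ j) ^+ 2 by rewrite exprAC.
rewrite !E2 !E2' !(exprS, expr0) ?mulr1.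
move: (q ^+ n) => w *.
field.
by repeat (apply/andP; split => //); apply: sub_neq0_div; rewrite // mulrAC.
Qed.

(** Passing from x to q^2 x corresponds to moving the starting index of the
    series by 2, hence the two additional terms on the left. *)
Lemma watson_rec n :
  \sum_(k < n.+2) watson_term q a b x k
  = watson_ratio q a b x * (\sum_(k < n) watson_term q a b (q ^+ 2 * x) k)
    + watson_rem q a b x n.
Proof.
elim: n => [|n IHn].
  by rewrite big_ord0 mulr0 add0r 2!big_ord_recr big_ord0 /= add0r watson_rec0.
rewrite big_ord_recr IHn [in RHS]big_ord_recr /= mulrDr -!addrA; congr (_ + _).
apply/eqP; rewrite -subr_eq0; have /eqP := watson_step n; rewrite -subr_eq0.
by apply: etrans; congr (_ == _); ring.
Qed.

End WatsonRecurrence.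

(** * Convergence of series of complex numbers *)

(** The convergence arguments use the complex numbers only through this
    property and [geometric_null], and are carried out over any field that has
    both. *)
Definition comparison_test (C : numClosedFieldType) : Prop :=
  forall u v : C ^nat, (forall n, `|u n| <= v n) ->
  cvgn (series v) -> cvgn (series u).

Definition geometric_null (C : numClosedFieldType) : Prop :=
  forall r : C, `|r| < 1 -> r ^+ n @[n --> \oo] --> 0.

Lemma pos_realC (R : realType) (e : R[i]) : 0 < e ->
  exists2 r : R, 0 < r & e = r%:C%C.
Proof.
move=> e0; exists (complex.Re e); last by rewrite RRe_real ?gtr0_real.
by move: e0; rewrite ltcE => /andP[].
Qed.

Lemma normC_real (R : realType) (x : R) : `|x%:C%C| = `|x|%:C%C :> R[i].
Proof. by rewrite normc_def /= expr0n addr0 sqrtr_sqr. Qed.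

Lemma norm_realC (R : realType) (z : R[i]) : `|z| = (complex.Re `|z|)%:C%C.
Proof. by rewrite RRe_real // normr_real. Qed.

Lemma cvg_realC (R : realType) (f : R ^nat) (l : R) : f @ \oo --> l ->
  @cvg_to (R[i] : numClosedFieldType) ((fun n => (f n)%:C%C) @ \oo)
    (nbhs (l%:C%C : (R[i] : numClosedFieldType))).
Proof.
move=> /cvgrPdist_lt h; apply/cvgrPdist_lt => e /pos_realC[r r0 ->].
near=> n; rewrite -rmorphB normC_real ltcR; near: n; exact: h.
Unshelve. all: by end_near. Qed.

Lemma normC_ge_Im (R : realType) (z : R[i]) : `|complex.Im z|%:C%C <= `|z|.
Proof.
rewrite normc_def lecR -sqrtr_sqr ler_sqrt ?sqr_ge0 ?addr_ge0 ?sqr_ge0 //.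
by rewrite lerDr sqr_ge0.
Qed.

(** The series of real parts and of imaginary parts converge absolutely, since
    each part is bounded by the norm, and the real numbers are complete. *)
Lemma complex_comparison (R : realType) : comparison_test R[i].
Proof.
move=> u v uv hv.
have hR : cvgn (series (fun n => complex.Re (v n))).
  apply: (cvgP (complex.Re (limn (series v)))).
  apply/cvgrPdist_lt => e e0.
  have e0' : (0 : R[i]) < e%:C%C by rewrite ltcR.
  move/cvgrPdist_lt: hv => /(_ _ e0') hv; near=> n.
  have : `|limn (series v) - series v n| < e%:C%C by near: n.
  have -> : series (fun k => complex.Re (v k)) n = complex.Re (series v n).
    by rewrite /series /= raddf_sum.
  by rewrite -raddfB -ltcR; apply: le_lt_trans; apply: normc_ge_Re.
have vR n : v n = (complex.Re (v n))%:C%C.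
  by rewrite RRe_real // ger0_real // (le_trans _ (uv n)).
have v0 n : 0 <= complex.Re (v n).
  by have := le_trans (normr_ge0 _) (uv n); rewrite vR ler0c.
have part (p : R[i] -> R) : (forall z, `|p z|%:C%C <= `|z|) ->
    cvgn (series (fun n => p (u n))).
  move=> hp; apply: normed_cvg; apply: series_le_cvg hR => n //=.
  rewrite -lecR; apply: le_trans (hp _) _; apply: le_trans (uv n) _.
  by rewrite -vR.
have := part _ (@normc_ge_Re R); have := part _ (@normC_ge_Im R).
move=> /cvg_realC hI /cvg_realC hRe.
have -> : series u = (fun n => (series (fun n => complex.Re (u n)) n)%:C%C
   + 'i%C * (series (fun n => complex.Im (u n)) n)%:C%C).
  apply/funext => n; rewrite /series /= !rmorph_sum mulr_sumr -big_split /=.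
  by apply: eq_bigr => k _; rewrite -complexE.
apply: cvgP; apply: cvgD hRe _; apply: cvgM hI; exact: cvg_cst.
Unshelve. all: by end_near. Qed.

Lemma norm_expC_lt (R : realType) (r : R[i]) (n : nat) (e : R) :
  `|complex.Re `|r| ^+ n| < e -> `|r ^+ n| < e%:C%C.
Proof.
move=> h; rewrite normrX norm_realC -(rmorphXn (real_complex R)) ltcR.
exact: le_lt_trans (ler_norm _) h.
Qed.

Lemma complex_geometric_null (R : realType) : geometric_null R[i].
Proof.
move=> r r1; apply/cvgrPdist_lt => e e0.
have [e' e0' ->] := pos_realC _ _ e0.
have : `|complex.Re `|r| | < 1.
  by rewrite -ltcR -normC_real -norm_realC normr_id.
move=> /cvg_expr/cvgrPdist_lt/(_ _ e0') h; near=> n.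
have : `|0 - complex.Re `|r| ^+ n| < e' by near: n.
rewrite !sub0r !normrN; exact: norm_expC_lt.
Unshelve. all: by end_near. Qed.

Lemma cvgnM {C : numClosedFieldType} (f g : C ^nat) (l m : C) :
  f n @[n --> \oo] --> l -> g n @[n --> \oo] --> m ->
  f n * g n @[n --> \oo] --> l * m.
Proof. exact: cvgM. Qed.

Lemma cvgnV {C : numClosedFieldType} (f : C ^nat) (l : C) : l != 0 ->
  f n @[n --> \oo] --> l -> (f n)^-1 @[n --> \oo] --> l^-1.
Proof. exact: cvgV. Qed.

Lemma cvgn_cst {C : numClosedFieldType} (c : C) : c @[_ --> \oo] --> c.
Proof. exact: cvg_cst. Qed.

Lemma eq_cvgn {C : numClosedFieldType} (f g : C ^nat) (l : C) :
  f n @[n --> \oo] --> l -> (forall n, f n = g n) -> g n @[n --> \oo] --> l.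
Proof. by move=> fl fg; rewrite (_ : g = f) //; apply/funext => n. Qed.

Lemma cvg_double {T : topologicalType} (u : nat -> T) (l : T) :
  u n @[n --> \oo] --> l -> u n.*2 @[n --> \oo] --> l.
Proof.
apply: cvg_comp => A [n _ hA]; exists n => // m /= nm; apply: hA => /=.
by rewrite -addnn (leq_trans nm) // leq_addr.
Qed.

Lemma cvg_series_stop {C : numClosedFieldType} (u : C ^nat) m :
  (forall k, (m <= k)%N -> u k = 0) ->
  series u n @[n --> \oo] --> series u m.
Proof.
move=> h; rewrite -(cvg_shiftn m).
rewrite (_ : [sequence _]_n = fun=> series u m); first exact: cvg_cst.
apply/funext => n /=; rewrite /series /= addnC (big_cat_nat (leq0n m)) ?leq_addr //=.
rewrite [X in _ + X](_ : _ = 0) ?addr0 // big_nat big1 // => k /andP[mk _].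
exact: h.
Qed.

Lemma sum_double {V : nmodType} (f : nat -> V) n :
  \sum_(N < n.*2) f N = \sum_(k < n) (f k.*2 + f k.*2.+1).
Proof.
elim: n => [|n IHn]; first by rewrite !big_ord0.
by rewrite doubleS !big_ord_recr IHn /= addrA.
Qed.

(** How a single sum splits into the two series on either side of the
    transformation. *)
Lemma cvg_even_odd {C : numClosedFieldType} (f u v : C ^nat) (s x y : C) :
  series f n @[n --> \oo] --> s ->
  cvgn (series u) -> cvgn (series v) ->
  (forall k, x * u k = f k.*2) -> (forall k, y * v k = f k.*2.+1) ->
  s = x * limn (series u) + y * limn (series v).
Proof.
move=> hf hu hv fu fv.
have h : x * series u n + y * series v n @[n --> \oo] -->
    x * limn (series u) + y * limn (series v).
  by apply: cvgD; apply: cvgM => //; exact: cvg_cst.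
rewrite -(cvg_lim (@norm_hausdorff _ _) (cvg_double _ _ hf)).
apply: cvg_lim; first exact: norm_hausdorff.
apply: (eq_cvgn _ _ _ h) => n.
rewrite /series /= !big_mkord sum_double big_split /= !mulr_sumr.
by congr (_ + _); apply: eq_bigr => k _; rewrite ?fu ?fv.
Qed.

Section Geometric.
Context {C : numClosedFieldType}.
Hypotheses (cmp : comparison_test C) (gn : geometric_null C).

Lemma sum_geom (r : C) m p :
  (\sum_(k <- iota m p) r ^+ k) * (1 - r) = r ^+ m - r ^+ (m + p).
Proof.
elim: p m => [|p IHp] m; first by rewrite big_nil mul0r addn0 subrr.
by rewrite big_cons mulrDl IHp addSnnS exprS; ring.
Qed.

Lemma cvg_geom (c r : C) : `|r| < 1 -> cvgn (series (fun n => c * r ^+ n)).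
Proof.
move=> r1; have r1' : 1 - r != 0.
  by rewrite subr_eq0; apply: contraTneq r1 => <-; rewrite normr1 ltxx.
have -> : series (fun n => c * r ^+ n) = (fun n => c * (1 - r ^+ n) / (1 - r)).
  apply/funext => n; rewrite /series /= -mulr_sumr.
  have := sum_geom r 0 n; rewrite expr0 add0n => <-.
  by rewrite mulrA mulfK // /index_iota subn0.
apply: cvgP; apply: cvgM; last exact: cvg_cst.
apply: cvgM; first exact: cvg_cst.
apply: cvgB; [exact: cvg_cst|exact: gn].
Qed.

Lemma cvg_geom_series (u : C ^nat) (c r : C) : `|r| < 1 ->
  (forall n, `|u n| <= c * r ^+ n) -> cvgn (series u).
Proof. by move=> r1 hu; exact: cmp hu (cvg_geom _ _ r1). Qed.

Lemma series_geom_tail (u : C ^nat) (c r : C) : 0 <= r < 1 ->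
  (forall n, `|u n| <= c * r ^+ n) ->
  forall m n, (m <= n)%N ->
  `|series u n - series u m| <= c * r ^+ m / (1 - r).
Proof.
move=> /andP[r0 r1] hu m n mn.
have c0 : 0 <= c.
  by have := le_trans (normr_ge0 _) (hu 0%N); rewrite expr0 mulr1.
rewrite /series /= -(subnKC mn) /index_iota !subn0 iotaD big_cat /= addrAC subrr add0r.
apply: le_trans (ler_norm_sum _ _ _) _.
apply: (@le_trans _ _ (\sum_(k <- iota m (n - m)) (c * r ^+ k))).
  by apply: ler_sum => k _; exact: hu.
rewrite ler_pdivlMr ?subr_gt0 // -mulr_sumr -mulrA.
rewrite ler_wpM2l //; rewrite sum_geom.
by rewrite gerBl exprn_ge0.
Qed.

Lemma lim_geom_tail (u : C ^nat) (c r : C) : 0 <= r < 1 ->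
  (forall n, `|u n| <= c * r ^+ n) ->
  forall m, `|limn (series u) - series u m| <= c * r ^+ m / (1 - r).
Proof.
move=> r01 hu m; have /andP[r0 r1] := r01.
have cu : cvgn (series u) by apply: cvg_geom_series hu; rewrite ger0_norm.
apply/ler_addgt0Pr => e e0.
move/cvgrPdist_le: cu => /(_ _ e0)[n _ hn].
have := hn _ (leq_maxl n m) => /= h1.
have := series_geom_tail _ _ _ r01 hu _ _ (leq_maxr n m) => h2.
rewrite -(subrK (series u (maxn n m)) (limn _)) -addrA addrC.
exact: le_trans (ler_normD _ _) (lerD h2 h1).
Qed.

Lemma exists_geom_le (V r e : C) : 0 <= V -> 0 <= r < 1 -> 0 < e ->
  exists m, V * r ^+ m <= e.
Proof.
move=> V0 /andP[r0 r1] e0; have V1 : 0 < V + 1 by rewrite ltr_wpDl.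
have r1' : `|r| < 1 by rewrite ger0_norm.
move/cvgrPdist_le: (gn _ r1') => /(_ _ (divr_gt0 e0 V1))[m _ hm].
exists m; have := hm m (leqnn m) => /=.
rewrite sub0r normrN ger0_norm ?exprn_ge0 // ler_pdivlMr // => h.
apply: le_trans h; rewrite mulrC ler_wpM2l ?exprn_ge0 //.
by rewrite lerDl.
Qed.

(** Dominated convergence for series with a geometric majorant: the tails are
    uniformly small and the finitely many remaining terms converge. *)
Lemma tannery (u : nat -> C ^nat) (v : C ^nat) (c r : C) : 0 <= r < 1 ->
  (forall n k, `|u n k| <= c * r ^+ k) ->
  (forall k, u n k @[n --> \oo] --> v k) ->
  cvgn (series v) /\ limn (series (u n)) @[n --> \oo] --> limn (series v).
Proof.
move=> r01 hu huv; have /andP[r0 r1] := r01.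
have hv k : `|v k| <= c * r ^+ k.
  apply/ler_addgt0Pr => e e0.
  move/cvgrPdist_le: (huv k) => /(_ _ e0)[n _ /(_ n (leqnn n)) /= h].
  rewrite -(subrK (u n k) (v k)) addrC.
  exact: le_trans (ler_normD _ _) (lerD (hu n k) h).
split; first by apply: cvg_geom_series hv; rewrite ger0_norm.
apply/cvgrPdist_le => e e0.
have c0 : 0 <= c.
  by have := le_trans (normr_ge0 _) (hv 0%N); rewrite expr0 mulr1.
have e3 : 0 < e / 3%:R by rewrite divr_gt0 // ltr0n.
have r1' : 0 < 1 - r by rewrite subr_gt0.
have [m hm] := exists_geom_le c r (e / 3%:R * (1 - r)) c0 r01 (mulr_gt0 e3 r1').
have {}hm : c * r ^+ m / (1 - r) <= e / 3%:R.
  by rewrite ler_pdivrMr.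
have : series (u n) m @[n --> \oo] --> series v m.
  rewrite /series /=; elim: {hm} m => [|m IHm].
    rewrite big_geq // (_ : (fun n => _) = fun=> 0); first exact: cvg_cst.
    by apply/funext => n; rewrite big_geq.
  rewrite big_nat_recr //=.
  rewrite (_ : (fun n => _) = fun n => \sum_(0 <= k < m) u n k + u n m).
    exact: cvgD.
  by apply/funext => n; rewrite big_nat_recr.
move/cvgrPdist_le => /(_ _ e3) hs; near=> n.
have h2 : `|series v m - series (u n) m| <= e / 3%:R by near: n.
have h1 := le_trans (lim_geom_tail _ _ _ r01 hv m) hm.
have h3 := le_trans (lim_geom_tail _ _ _ r01 (hu n) m) hm.
rewrite distrC in h3.
have -> : limn (series v) - limn (series (u n))
  = (limn (series v) - series v m) + (series v m - series (u n) m)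
    + (series (u n) m - limn (series (u n))) by ring.
have -> : e = e / 3%:R + e / 3%:R + e / 3%:R by field.
by apply: le_trans (ler_normD _ _) (lerD (le_trans (ler_normD _ _) (lerD h1 h2)) h3).
Unshelve. all: by end_near. Qed.

End Geometric.

(** * Infinite q-Pochhammer symbols *)

Lemma nonvanishing_small {C : numClosedFieldType} (v p : C) :
  `|v| < 1 -> `|p| < 1 -> nonvanishing v p.
Proof.
move=> v1 p1 j; rewrite subr_eq0; apply/eqP => e.
have : `|v * p ^+ j| < 1.
  rewrite normrM normrX; apply: le_lt_trans v1.
  by rewrite ler_piMr // exprn_ile1 // ltW.
by rewrite -e normr1 ltxx.
Qed.

Section QPoch.
Context {C : numClosedFieldType}.
Hypotheses (cmp : comparison_test C) (gn : geometric_null C).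
Variable q : C.
Hypothesis q1 : `|q| < 1.

Let r := `|q|.
Let r01 : 0 <= r < 1. Proof. by rewrite /r normr_ge0. Qed.
Let r1 : 0 < 1 - r. Proof. by rewrite subr_gt0. Qed.

Lemma norm_qfactor (v : C) j : `|v * q ^+ j| = `|v| * r ^+ j.
Proof. by rewrite normrM normrX. Qed.

Lemma sum_geom_half (w : C) n : 0 <= w -> w <= (1 - r) / 2%:R ->
  \sum_(j < n) w * r ^+ j <= 2%:R^-1.
Proof.
move=> w0 hw; rewrite -mulr_sumr -(big_mkord predT (fun j => r ^+ j)).
rewrite /index_iota subn0 -(ler_pM2r r1) -mulrA sum_geom expr0 add0n.
apply: (@le_trans _ _ w); last by rewrite mulrC.
by rewrite ler_piMr // gerBl exprn_ge0 // /r normr_ge0.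
Qed.

(** The Weierstrass inequality for products. *)
Lemma qpoch_ge_sum (v : C) n : `|v| <= 1 ->
  1 - \sum_(j < n) `|v| * r ^+ j <= `|qpoch v q n|.
Proof.
move=> v1; elim: n => [|n IHn]; first by rewrite big_ord0 subr0 qpoch0 normr1.
have [r0 /ltW r1'] := andP r01.
have w0 : 0 <= `|v| * r ^+ n by rewrite mulr_ge0 // exprn_ge0.
have w1 : `|v| * r ^+ n <= 1 by rewrite mulr_ile1 // ?exprn_ge0 ?exprn_ile1.
rewrite qpochS normrM big_ord_recr /=.
set S := \sum_(i < n) _ in IHn *; set w := _ * _ in w0 w1 *.
have S0 : 0 <= S by apply: sumr_ge0 => i _; rewrite mulr_ge0 // exprn_ge0.
have h : 1 - w <= `|1 - v * q ^+ n|.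
  have := lerB_dist 1 (v * q ^+ n); by rewrite normr1 norm_qfactor.
apply: (@le_trans _ _ (`|qpoch v q n| * (1 - w))); last first.
  by rewrite ler_wpM2l.
apply: (@le_trans _ _ ((1 - S) * (1 - w))); last first.
  by rewrite ler_wpM2r // subr_ge0.
rewrite (_ : (1 - S) * (1 - w) = 1 - (S + w) + S * w); last by ring.
by rewrite lerDl mulr_ge0.
Qed.

Lemma qpoch_ge_half (v : C) n : `|v| <= (1 - r) / 2%:R ->
  2%:R^-1 <= `|qpoch v q n|.
Proof.
move=> hv; have [r0 r1'] := andP r01.
apply: le_trans (qpoch_ge_sum _ _ _).
  rewrite lerBrDl addrC -lerBrDl (_ : 1 - 2%:R^-1 = 2%:R^-1); last by field.
  by apply: sum_geom_half.
apply: le_trans hv _; rewrite ler_pdivrMr ?ltr0n // mul1r.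
by apply: (@le_trans _ _ 1); [rewrite gerBl | rewrite ler1n].
Qed.

(** The symbol is dominated by the product of the 1 + V |q|^j.  Beyond an index
    m with V |q|^m <= (1 - |q|) / 2 this product is at most 2, because the
    product of the 1 + u_j times 1 minus the sum of the u_j is at most 1. *)
Lemma qpoch_le (V : C) : 0 <= V ->
  exists2 M, 0 < M & forall (v : C) n, `|v| <= V -> `|qpoch v q n| <= M.
Proof.
move=> V0; have [r0 r1'] := andP r01.
pose B (w : C) n := \prod_(j < n) (1 + w * r ^+ j).
have B1 (w : C) n : 0 <= w -> 1 <= B w n.
  move=> w0; rewrite /B; elim/big_rec: _ => // j x _ x1.
  by rewrite mulr_ege1 // lerDl mulr_ge0 // exprn_ge0.
have BS (w : C) n : B w n.+1 = B w n * (1 + w * r ^+ n) by rewrite /B big_ord_recr.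
have BD w m n : B w (m + n)%N = B w m * B (w * r ^+ m) n.
  elim: n => [|n IHn]; first by rewrite addn0 /B big_ord0 mulr1.
  by rewrite addnS !BS IHn exprD !mulrA.
have B2 w n : 0 <= w -> w <= (1 - r) / 2%:R -> B w n <= 2%:R.
  move=> w0 hw.
  have : B w n * (1 - \sum_(j < n) w * r ^+ j) <= 1.
    elim: n => [|n IHn]; first by rewrite big_ord0 subr0 mulr1 /B big_ord0.
    rewrite BS big_ord_recr /=; apply: le_trans IHn.
    rewrite -mulrA ler_wpM2l ?(le_trans ler01) ?B1 //.
    set S := \sum_(i < n) _; set u := w * _.
    have u0 : 0 <= u by rewrite mulr_ge0 // exprn_ge0.
    have S0 : 0 <= S by apply: sumr_ge0 => i _; rewrite mulr_ge0 // exprn_ge0.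
    rewrite (_ : _ * _ = 1 - S - (S * u + u ^+ 2)); last by ring.
    by rewrite gerBl addr_ge0 ?mulr_ge0 ?exprn_ge0.
  have hs : 2%:R^-1 <= 1 - \sum_(j < n) w * r ^+ j.
    rewrite lerBrDl addrC -lerBrDl (_ : 1 - 2%:R^-1 = 2%:R^-1); last by field.
    exact: sum_geom_half.
  move=> h; rewrite -[2%:R]mul1r -ler_pdivrMr ?ltr0n //; apply: le_trans h.
  by rewrite ler_wpM2l // (le_trans ler01) ?B1.
have [m hm] := exists_geom_le gn V r _ V0 r01 (divr_gt0 r1 (ltr0n C 2)).
exists (B V m * 2%:R) => [|v n vV].
  by rewrite mulr_gt0 ?ltr0n // (lt_le_trans ltr01) ?B1.
apply: (@le_trans _ _ (B V n)).
  rewrite /qpoch normr_prod; apply: ler_prod => j _; rewrite normr_ge0 /=.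
  apply: le_trans (ler_normB _ _) _; rewrite normr1 norm_qfactor lerD2l.
  by rewrite ler_wpM2r ?exprn_ge0.
apply: (@le_trans _ _ (B V (m + n)%N)).
  rewrite addnC BD ler_peMr ?(le_trans ler01) ?B1 //.
  by rewrite mulr_ge0 // exprn_ge0.
rewrite BD ler_wpM2l ?(le_trans ler01) ?B1 //; apply: B2 => //.
by rewrite mulr_ge0 // exprn_ge0.
Qed.

(** The tail beyond a large index has norm at least 1/2, and the finitely many
    factors before it are nonzero.  Writing a shifted symbol as a quotient makes
    the bound uniform in the shift n. *)
Lemma qpoch_ge (v : C) : nonvanishing v q ->
  exists2 c, 0 < c & forall n k, c <= `|qpoch (v * q ^+ n) q k|.
Proof.
move=> hv; have [M M0 hM] := qpoch_le _ (normr_ge0 v).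
have [m hm] := exists_geom_le gn _ r _ (normr_ge0 v) r01 (divr_gt0 r1 (ltr0n C 2)).
have tail k : 2%:R^-1 <= `|qpoch (v * q ^+ m) q k|.
  by apply: qpoch_ge_half; rewrite norm_qfactor.
have M10 : 0 < M + 1 by rewrite addr_gt0.
have p0 : 0 < `|qpoch v q m| by rewrite normr_gt0 qpoch_neq0.
have [c c0 hc] : exists2 c, 0 < c & forall n, c <= `|qpoch v q n|.
  exists (`|qpoch v q m| * 2%:R^-1 / (M + 1)) => [|n].
    by rewrite !mulr_gt0 ?invr_gt0 ?ltr0n.
  rewrite ler_pdivrMr //.
  apply: (@le_trans _ _ `|qpoch v q (m + n)|).
    by rewrite qpochD normrM ler_wpM2l.
  rewrite addnC qpochD normrM ler_wpM2l //.
  apply: (@le_trans _ _ M); last by rewrite lerDl.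
  by apply: hM; rewrite norm_qfactor ler_piMr // exprn_ile1 ?normr_ge0 ?(ltW q1).
exists (c / M) => [|n k]; first by rewrite divr_gt0.
rewrite (qpoch_drop hv) normrM normfV; apply: ler_pM.
- exact: ltW.
- by rewrite invr_ge0 ltW.
- exact: hc.
- by rewrite lef_pV2 ?posrE ?normr_gt0 ?qpoch_neq0 //; exact: hM.
Qed.

(** The increments are -x q^n times a bounded symbol. *)
Lemma cvg_qpoch (x : C) : qpoch x q n @[n --> \oo] --> qpoch_inf x q.
Proof.
have [M M0 hM] := qpoch_le _ (normr_ge0 x).
have : cvgn (series (fun n => qpoch x q n.+1 - qpoch x q n)).
  apply: (cvg_geom_series cmp gn _ (M * `|x|) r) => [|n]; first by rewrite /r normr_id.
  rewrite qpochS mulrBr mulr1 addrAC subrr add0r normrN normrM norm_qfactor.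
  by rewrite -mulrA ler_wpM2r ?hM // mulr_ge0 // exprn_ge0 // /r normr_ge0.
rewrite (_ : series _ = (fun n => qpoch x q n - 1)); last first.
  by apply/funext => n; rewrite /series /= telescope_sumr // qpoch0.
move=> h; have : cvgn (fun n => qpoch x q n - 1 + 1).
  by apply: is_cvgD h _; apply: is_cvg_cst.
by under eq_fun do rewrite subrK.
Qed.

Lemma qpoch_inf_eq (x l : C) : qpoch x q n @[n --> \oo] --> l -> qpoch_inf x q = l.
Proof. by apply: cvg_lim; exact: norm_hausdorff. Qed.

Lemma qpoch_inf_neq0 (x : C) : nonvanishing x q -> qpoch_inf x q != 0.
Proof.
move=> /qpoch_ge[c c0 /(_ 0%N) hc]; apply/eqP => e0.
have := cvg_qpoch x; rewrite e0 => /cvgrPdist_lt/(_ _ c0)[n _ /(_ n (leqnn n))] /=.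
rewrite sub0r normrN; have := hc n; rewrite expr0 mulr1 => h1 h2.
by have := le_lt_trans h1 h2; rewrite ltxx.
Qed.

Lemma qpoch_infD (x : C) n :
  qpoch_inf x q = qpoch x q n * qpoch_inf (x * q ^+ n) q.
Proof.
apply: qpoch_inf_eq; rewrite -(cvg_shiftn n).
rewrite (_ : [sequence _]_ _ = fun m => qpoch x q n * qpoch (x * q ^+ n) q m).
  by apply: cvgM; [exact: cvg_cst|exact: cvg_qpoch].
by apply/funext => m /=; rewrite addnC qpochD.
Qed.

End QPoch.

(** Two indices, because the majorants have to be uniform in the index of
    summation and in a shift of the parameters at the same time. *)
Definition unif_bounded {C : numClosedFieldType} (f : nat -> nat -> C) : Prop :=
  exists M, forall n k, `|f n k| <= M.

Section Bounds.
Context {C : numClosedFieldType}.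
Hypotheses (cmp : comparison_test C) (gn : geometric_null C).

Lemma unif_boundedM (f g : nat -> nat -> C) : unif_bounded f -> unif_bounded g ->
  unif_bounded (fun n k => f n k * g n k).
Proof.
by move=> [M hM] [N hN]; exists (M * N) => n k; rewrite normrM ler_pM.
Qed.

Lemma unif_bounded_cst (c : C) : unif_bounded (fun _ _ => c).
Proof. by exists `|c|. Qed.

Lemma unif_bounded_factor (v q : C) (e : nat -> nat -> nat) : `|q| < 1 ->
  unif_bounded (fun n k => 1 - v * q ^+ e n k).
Proof.
move=> q1; exists (1 + `|v|) => n k.
apply: le_trans (ler_normB _ _) _; rewrite normr1 lerD2l normrM normrX.
by rewrite ler_piMr // exprn_ile1 // ltW.
Qed.

Lemma unif_bounded_qpoch (v q : C) (s t : nat -> nat -> nat) : `|q| < 1 ->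
  unif_bounded (fun n k => qpoch (v * q ^+ s n k) q (t n k)).
Proof.
move=> q1; have [M _ hM] := qpoch_le gn q q1 _ (normr_ge0 v).
exists M => n k; apply: hM; rewrite normrM normrX.
by rewrite ler_piMr // exprn_ile1 // ltW.
Qed.

Lemma unif_bounded_qpochV (v q : C) (s t : nat -> nat -> nat) : `|q| < 1 ->
  nonvanishing v q ->
  unif_bounded (fun n k => (qpoch (v * q ^+ s n k) q (t n k))^-1).
Proof.
move=> q1 hv; have [c c0 hc] := qpoch_ge gn q q1 _ hv.
exists c^-1 => n k; rewrite normfV lef_pV2 ?posrE ?normr_gt0 //.
by rewrite qpoch_neq0 //; exact: nonvanishing_shift.
Qed.

Lemma cvg_qpoch_at0 (f : C ^nat) q k : f n @[n --> \oo] --> 0 ->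
  qpoch (f n) q k @[n --> \oo] --> (1 : C).
Proof.
move=> hf; elim: k => [|k IHk].
  under eq_fun do rewrite qpoch0; exact: cvg_cst.
under eq_fun do rewrite qpochS.
have h : 1 - f n * q ^+ k @[n --> \oo] --> (1 : C).
  have := cvgB (cvg_cst (1 : C)) (cvgM hf (cvg_cst (q ^+ k))).
  by rewrite mul0r subr0; apply.
by have := cvgM IHk h; rewrite mulr1; apply.
Qed.

(** After finitely many steps no factor vanishes; from then on the shifted
    symbol is the infinite product divided by its partial products. *)
Lemma cvg_qpoch_inf_shift (v q : C) : `|q| < 1 ->
  qpoch_inf (v * q ^+ n) q @[n --> \oo] --> (1 : C).
Proof.
move=> q1.
have r01 : 0 <= `|q| < 1 by rewrite normr_ge0.
have r1 : 0 < 1 - `|q| by rewrite subr_gt0.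
have [m hm] := exists_geom_le gn _ `|q| _ (normr_ge0 v) r01 (divr_gt0 r1 (ltr0n C 2)).
have hv : nonvanishing (v * q ^+ m) q.
  move=> j; rewrite -normr_gt0 -(qpoch1 _ q); apply: lt_le_trans (qpoch_ge_half q q1 _ 1 _).
    by rewrite invr_gt0 ltr0n.
  rewrite !normrM !normrX; apply: le_trans hm.
  by rewrite ler_piMr ?mulr_ge0 ?exprn_ge0 // exprn_ile1 // ltW.
have p0 := qpoch_inf_neq0 cmp gn q q1 _ hv.
rewrite -(cvg_shiftn m).
rewrite (_ : [sequence _]_n = fun n => qpoch_inf (v * q ^+ m) q / qpoch (v * q ^+ m) q n).
  rewrite -(mulfV p0); apply: cvgM; first exact: cvg_cst.
  by apply: cvgV => //; exact: cvg_qpoch.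
apply/funext => n /=; rewrite (qpoch_infD cmp gn q q1 (v * q ^+ m) n).
by rewrite mulrAC mulfV ?(qpoch_neq0 hv) // mul1r -mulrA -exprD addnC.
Qed.

Lemma cvg_qpoch_inf_sub (v p : C) (e : nat -> nat) : `|p| < 1 ->
  (forall n, (n <= e n)%N) ->
  qpoch_inf (v * p ^+ e n) p @[n --> \oo] --> (1 : C).
Proof.
move=> p1 he; apply: cvg_comp (cvg_qpoch_inf_shift _ _ p1).
by move=> A [m _ hA]; exists m => // n /= mn; apply: hA; exact: leq_trans (he n).
Qed.

End Bounds.

(** * The q-analogue of Watson's 3F2 sum *)

(** No denominator of the terms vanishes.  The symbol with parameter q x^2 is
    in the numerator, but the recurrence divides by its factors. *)
Definition watson_ok {C : numClosedFieldType} (q a b x : C) : Prop :=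
  [/\ nonvanishing (q * x ^+ 2) q, nonvanishing (a * q * x ^+ 2) q,
      nonvanishing (a * b * x) q, nonvanishing (q ^+ 2 * x / b) q
    & nonvanishing (q ^+ 3 * x ^+ 2 / a) (q ^+ 2)].

(** Denominator and numerator of the product evaluation, without the factors
    that do not depend on x. *)
Definition watson_den {C : numClosedFieldType} (q a b x : C) : C :=
  qpoch_inf (a * b * x) q * qpoch_inf (q ^+ 2 * x / b) q
  * qpoch_inf (q ^+ 3 * x ^+ 2 / a) (q ^+ 2)
  * qpoch_inf (a * q ^+ 2 * x ^+ 2) (q ^+ 2).

Definition watson_num {C : numClosedFieldType} (q a b x : C) : C :=
  qpoch_inf (q * x ^+ 2) q
  * (qpoch_inf (b * q * x) (q ^+ 2) * qpoch_inf (q ^+ 3 * x / (a * b)) (q ^+ 2)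
     * qpoch_inf (a * q ^+ 2 * x / b) (q ^+ 2)
     * qpoch_inf (a ^+ 2 * b * x) (q ^+ 2)).

Lemma watson_ok_shift {C : numClosedFieldType} (q a b x : C) :
  watson_ok q a b x -> watson_ok q a b (q ^+ 2 * x).
Proof.
case=> h1 h2 h3 h4 h5; split.
- rewrite (_ : q * _ = q * x ^+ 2 * q ^+ 4); last by ring.
  exact: nonvanishing_shift.
- rewrite (_ : a * q * _ = a * q * x ^+ 2 * q ^+ 4); last by ring.
  exact: nonvanishing_shift.
- rewrite (_ : a * b * _ = a * b * x * q ^+ 2); last by ring.
  exact: nonvanishing_shift.
- rewrite (_ : _ / b = q ^+ 2 * x / b * q ^+ 2); last by ring.
  exact: nonvanishing_shift.
- rewrite (_ : _ / a = q ^+ 3 * x ^+ 2 / a * (q ^+ 2) ^+ 2); last by ring.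
  exact: nonvanishing_shift.
Qed.

Lemma watson_ok_shiftn {C : numClosedFieldType} (q a b x : C) n :
  watson_ok q a b x -> watson_ok q a b (q ^+ (2 * n) * x).
Proof.
move=> h; elim: n => [|n IHn]; first by rewrite muln0 expr0 mul1r.
by rewrite mulnS exprD -mulrA; exact: watson_ok_shift.
Qed.

Section WatsonLimit.
Context {C : numClosedFieldType}.
Hypotheses (cmp : comparison_test C) (gn : geometric_null C).
Variables (q a b : C).
Hypotheses (q0 : q != 0) (q1 : `|q| < 1) (a0 : a != 0) (b0 : b != 0).

Let q2 : `|q ^+ 2| < 1. Proof. by rewrite normrX expr_lt1. Qed.

Let qn : nonvanishing q q. Proof. exact: nonvanishing_small. Qed.

Definition watson_num_ratio (x : C) : C :=
  qpoch (q * x ^+ 2) q 4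
  * ((1 - b * q * x) * (1 - q ^+ 3 * x / (a * b)) * (1 - a * q ^+ 2 * x / b)
     * (1 - a ^+ 2 * b * x)).

Lemma watson_num_rec x :
  watson_num q a b x = watson_num_ratio x * watson_num q a b (q ^+ 2 * x).
Proof.
rewrite /watson_num /watson_num_ratio (qpoch_infD cmp gn q q1 (q * x ^+ 2) 4).
rewrite (qpoch_infD cmp gn _ q2 (b * q * x) 1) (qpoch_infD cmp gn _ q2 (_ / (a * b)) 1).
rewrite (qpoch_infD cmp gn _ q2 (a * q ^+ 2 * x / b) 1).
rewrite (qpoch_infD cmp gn _ q2 (a ^+ 2 * b * x) 1) !qpoch1 !expr1.
have -> : q * (q ^+ 2 * x) ^+ 2 = q * x ^+ 2 * q ^+ 4 by ring.
have -> : b * q * (q ^+ 2 * x) = b * q * x * q ^+ 2 by ring.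
have -> : q ^+ 3 * (q ^+ 2 * x) / (a * b) = q ^+ 3 * x / (a * b) * q ^+ 2 by ring.
have -> : a * q ^+ 2 * (q ^+ 2 * x) / b = a * q ^+ 2 * x / b * q ^+ 2 by ring.
have -> : a ^+ 2 * b * (q ^+ 2 * x) = a ^+ 2 * b * x * q ^+ 2 by ring.
ring.
Qed.

Lemma watson_den_rec x : watson_ok q a b x ->
  watson_den q a b x * watson_ratio q a b x
  = watson_num_ratio x * watson_den q a b (q ^+ 2 * x).
Proof.
case=> h1 h2 h3 h4 h5.
rewrite /watson_den /watson_num_ratio /watson_ratio (qpoch_infD cmp gn q q1 (a * b * x) 2).
rewrite (qpoch_infD cmp gn _ q1 (q ^+ 2 * x / b) 2).
rewrite (qpoch_infD cmp gn _ q2 (q ^+ 3 * x ^+ 2 / a) 2).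
rewrite (qpoch_infD cmp gn _ q2 (a * q ^+ 2 * x ^+ 2) 2).
have -> : a * b * (q ^+ 2 * x) = a * b * x * q ^+ 2 by ring.
have -> : q ^+ 2 * (q ^+ 2 * x) / b = q ^+ 2 * x / b * q ^+ 2 by ring.
have -> : q ^+ 3 * (q ^+ 2 * x) ^+ 2 / a = q ^+ 3 * x ^+ 2 / a * (q ^+ 2) ^+ 2 by ring.
have -> : a * q ^+ 2 * (q ^+ 2 * x) ^+ 2 = a * q ^+ 2 * x ^+ 2 * (q ^+ 2) ^+ 2 by ring.
have h6 : nonvanishing (a * q ^+ 2 * x ^+ 2) (q ^+ 2).
  move=> j; rewrite (_ : _ * _ = a * q * x ^+ 2 * q ^+ (2 * j).+1) //.
  by rewrite (exprS q (2 * j)) (exprM q 2 j); ring.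
have := qpoch_neq0 h3 2; have := qpoch_neq0 h4 2; have := qpoch_neq0 h5 2.
have := qpoch_neq0 h6 2.
atoms.
by move=> *; field; repeat (apply/andP; split => //).
Qed.

Definition watson_sum (x : C) : C := limn (series (watson_term q a b x)).

Lemma watson_sum_rec x : watson_ok q a b x ->
  cvgn (series (watson_term q a b (q ^+ 2 * x))) ->
  watson_rem q a b x n @[n --> \oo] --> 0 ->
  cvgn (series (watson_term q a b x)) /\
  watson_den q a b x * watson_sum x
  = watson_num_ratio x * (watson_den q a b (q ^+ 2 * x) * watson_sum (q ^+ 2 * x)).
Proof.
move=> ok cx r0; have [h1 h2 h3 h4 h5] := ok.
have h : series (watson_term q a b x) n @[n --> \oo] -->
    watson_ratio q a b x * watson_sum (q ^+ 2 * x).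
  rewrite -(cvg_shiftn 2) -[watson_ratio q a b x * _]addr0.
  rewrite (_ : [sequence _]_n = fun n => watson_ratio q a b x
      * series (watson_term q a b (q ^+ 2 * x)) n + watson_rem q a b x n).
    by apply: cvgD r0; apply: cvgM cx; exact: cvg_cst.
  apply/funext => n /=; rewrite /series /= !big_mkord addn2.
  by rewrite watson_rec.
split; first exact: cvgP h.
rewrite /watson_sum (cvg_lim (@norm_hausdorff _ _) h) mulrA watson_den_rec //.
by rewrite -!mulrA.
Qed.

Lemma watson_term0 x : watson_term q a b x 0 = 1 - q * x ^+ 2.
Proof. by rewrite /watson_term !qpoch0 muln0 !expr0; field. Qed.

(** Here b x = q^(-m), and the recurrence lowers m by 2.  For m = 0 the series
    has a single term; for m = 1 both sides vanish. *)
Lemma watson_sum_terminating m x : watson_ok q a b x -> b * x * q ^+ m = 1 ->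
  cvgn (series (watson_term q a b x)) /\
  watson_den q a b x * watson_sum x
    * (qpoch_inf q (q ^+ 2) * qpoch_inf (a ^+ 2) (q ^+ 2))
  = qpoch_inf a q * watson_num q a b x.
Proof.
have [k] := ubnP m; elim: k m x => // k IHk [|[|m]] x mk ok bx1.
- rewrite expr0 mulr1 in bx1.
  have h : series (watson_term q a b x) n @[n --> \oo] --> series (watson_term q a b x) 1.
    apply: cvg_series_stop => -[//|j] _.
    by rewrite /watson_term (qpochSl (b * x)) bx1 subrr !(mul0r, mulr0).
  split; first exact: cvgP h.
  rewrite /watson_sum (cvg_lim (@norm_hausdorff _ _) h) /series /= big_nat1.
  rewrite watson_term0 /watson_den /watson_num.
  have bx : b^-1 = x by apply: (mulfI b0); rewrite mulfV.
  have -> : a * b * x = a by rewrite -mulrA bx1 mulr1.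
  have -> : q ^+ 2 * x / b = q * x ^+ 2 * q ^+ 1 by rewrite bx; ring.
  have -> : b * q * x = q by rewrite mulrAC bx1 mul1r.
  have -> : q ^+ 3 * x / (a * b) = q ^+ 3 * x ^+ 2 / a.
    by rewrite invfM bx; ring.
  have -> : a * q ^+ 2 * x / b = a * q ^+ 2 * x ^+ 2 by rewrite bx; ring.
  have -> : a ^+ 2 * b * x = a ^+ 2 by rewrite -mulrA bx1 mulr1.
  rewrite (qpoch_infD cmp gn q q1 (q * x ^+ 2) 1) qpoch1; ring.
- rewrite expr1 in bx1; have bqx : b * q * x = 1 by rewrite mulrAC.
  have rem0 n : watson_rem q a b x n = 0.
    by rewrite /watson_rem (qpochSl (b * q * x)) bqx subrr !(mul0r, mulr0).
  have h : series (watson_term q a b x) n @[n --> \oo] --> 0.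
    rewrite -(cvg_shiftn 2) (_ : [sequence _]_n = fun=> 0); first exact: cvg_cst.
    have [h1 h2 h3 h4 h5] := ok.
    apply/funext => n /=; rewrite /series /= big_mkord addn2 watson_rec // rem0.
    by rewrite /watson_ratio bqx subrr !(mul0r, mulr0) add0r.
  split; first exact: cvgP h.
  rewrite /watson_sum (cvg_lim (@norm_hausdorff _ _) h) /watson_num bqx.
  by rewrite (qpoch_infD cmp gn _ q2 1 1) qpoch1 subrr !(mul0r, mulr0).
- have bx2 : b * (q ^+ 2 * x) * q ^+ m = 1 by rewrite -bx1 !exprS expr0; ring.
  have [cx hx] := IHk _ _ (ltnW mk) (watson_ok_shift _ _ _ _ ok) bx2.
  have rem0 : watson_rem q a b x n @[n --> \oo] --> 0.
    rewrite -(cvg_shiftn m.+1) (_ : [sequence _]_n = fun=> 0); first exact: cvg_cst.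
    apply/funext => n /=; rewrite /watson_rem.
    rewrite (_ : qpoch (b * q * x) q _ = 0); first by rewrite !(mul0r, mulr0).
    rewrite (_ : (n + m.+1).+1 = (m.+2 + n)%N); last by lia.
    rewrite qpochD qpochS (_ : b * q * x * q ^+ m.+1 = 1).
      by rewrite subrr mulr0 mul0r.
    by rewrite -bx1 !exprS; ring.
  have [cx' hx'] := watson_sum_rec _ ok cx rem0; split=> //.
  by rewrite hx' watson_num_rec -mulrA hx; ring.
Qed.

End WatsonLimit.

Lemma mul_cross {F : comRingType} (x y x' y' t : F) :
  x = t * x' -> y = t * y' -> x * y' = y * x'.
Proof. by move=> -> ->; rewrite mulrAC. Qed.

Section WatsonNonterm.
Context {C : numClosedFieldType}.
Hypotheses (cmp : comparison_test C) (gn : geometric_null C).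
Variables (q a b : C).
Hypotheses (q0 : q != 0) (q1 : `|q| < 1) (a0 : a != 0) (b0 : b != 0).

Let q2 : `|q ^+ 2| < 1. Proof. by rewrite normrX expr_lt1. Qed.

Let qn : nonvanishing q q. Proof. exact: nonvanishing_small. Qed.

(** Uniformity in n is what Tannery's theorem needs when x is replaced by
    q^(2n) x. *)
Lemma watson_term_bound x : watson_ok q a b x ->
  exists c, forall n k, `|watson_term q a b (q ^+ (2 * n) * x) k| <= c * `|a| ^+ k.
Proof.
move=> [h1 h2 h3 h4 h5].
have : unif_bounded (fun n k =>
   (1 - q * x ^+ 2 * q ^+ (4 * n + 2 * k))
  * (qpoch (q * x ^+ 2 * q ^+ (4 * n)) q k * qpoch (q / a * q ^+ 0) q k
     * qpoch (q ^+ 2 * x / (a * b) * q ^+ (2 * n)) q k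
     * qpoch (b * x * q ^+ (2 * n)) q k
     * qpoch (q * a * x ^+ 2 * (q ^+ 2) ^+ (2 * n)) (q ^+ 2) k)
  * ((qpoch (q * q ^+ 0) q k)^-1 * (qpoch (a * q * x ^+ 2 * q ^+ (4 * n)) q k)^-1
     * (qpoch (a * b * x * q ^+ (2 * n)) q k)^-1
     * (qpoch (q ^+ 2 * x / b * q ^+ (2 * n)) q k)^-1
     * (qpoch (q ^+ 3 * x ^+ 2 / a * (q ^+ 2) ^+ (2 * n)) (q ^+ 2) k)^-1)).
  do ?[apply: unif_boundedM]; try exact: unif_bounded_factor;
    try exact: unif_bounded_qpoch; exact: unif_bounded_qpochV.
move=> [M hM]; exists M => n k; rewrite /watson_term.
have E : q ^+ (4 * n) = (q ^+ (2 * n)) ^+ 2.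
  by rewrite -exprM; congr (_ ^+ _); lia.
have E2 : (q ^+ 2) ^+ (2 * n) = (q ^+ (2 * n)) ^+ 2 by rewrite -!exprM mulnC.
have := hM n k; rewrite exprD E E2 expr0 !mulr1; set y := q ^+ (2 * n).
have -> : q * x ^+ 2 * y ^+ 2 = q * (y * x) ^+ 2 by ring.
have -> : a * q * x ^+ 2 * y ^+ 2 = a * q * (y * x) ^+ 2 by ring.
have -> : q ^+ 2 * x / (a * b) * y = q ^+ 2 * (y * x) / (a * b) by ring.
have -> : b * x * y = b * (y * x) by ring.
have -> : q * a * x ^+ 2 * y ^+ 2 = q * a * (y * x) ^+ 2 by ring.
have -> : a * b * x * y = a * b * (y * x) by ring.
have -> : q ^+ 2 * x / b * y = q ^+ 2 * (y * x) / b by ring.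
have -> : q ^+ 3 * x ^+ 2 / a * y ^+ 2 = q ^+ 3 * (y * x) ^+ 2 / a by ring.
have -> : q * x ^+ 2 * (y ^+ 2 * q ^+ (2 * k)) = q * (y * x) ^+ 2 * q ^+ (2 * k) by ring.
rewrite -!invfM => h.
rewrite mulrAC normrM normrX normrN.
by rewrite ler_wpM2r ?exprn_ge0.
Qed.

Lemma watson_rem_bound x : watson_ok q a b x ->
  exists c, forall n, `|watson_rem q a b x n| <= c * `|a| ^+ n.
Proof.
move=> [h1 h2 h3 h4 h5].
have : unif_bounded (fun n (_ : nat) =>
   (1 - a) * (1 - a * q ^+ 2 * x ^+ 2)
  * (qpoch (q * x ^+ 2 * q ^+ 0) q n.+2 * qpoch (q / a * q ^+ 0) q n
     * qpoch (q ^+ 3 * x / (a * b) * q ^+ 0) q n.+1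
     * qpoch (b * q * x * q ^+ 0) q n.+1
     * qpoch (q * a * x ^+ 2 * (q ^+ 2) ^+ 0) (q ^+ 2) n.+2)
  * ((qpoch (q * q ^+ 0) q n.+1)^-1 * (qpoch (a * q * x ^+ 2 * q ^+ 0) q n.+3)^-1
     * (qpoch (a * b * x * q ^+ 0) q n.+1)^-1
     * (qpoch (q ^+ 2 * x / b * q ^+ 0) q n.+1)^-1
     * (qpoch (q ^+ 3 * x ^+ 2 / a * (q ^+ 2) ^+ 0) (q ^+ 2) n.+1)^-1)).
  do ?[apply: unif_boundedM]; try exact: unif_bounded_cst;
    try exact: (unif_bounded_qpoch gn _ _ (fun _ _ => 0%N) (fun n _ => n));
    try exact: (unif_bounded_qpoch gn _ _ (fun _ _ => 0%N) (fun n _ => n.+1));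
    try exact: (unif_bounded_qpoch gn _ _ (fun _ _ => 0%N) (fun n _ => n.+2));
    try exact: (unif_bounded_qpochV gn _ _ (fun _ _ => 0%N) (fun n _ => n.+1));
    try exact: (unif_bounded_qpochV gn _ _ (fun _ _ => 0%N) (fun n _ => n.+3)).
move=> [M hM]; exists M => n; have := hM n 0; rewrite !expr0 !mulr1 /watson_rem.
rewrite -!invfM => h.
rewrite (_ : _ / _ = ((1 - a) * (1 - a * q ^+ 2 * x ^+ 2)
   * (qpoch (q * x ^+ 2) q n.+2 * qpoch (q / a) q n *
    qpoch (q ^+ 3 * x / (a * b)) q n.+1 * qpoch (b * q * x) q n.+1 *
    qpoch (q * a * x ^+ 2) (q ^+ 2) n.+2)
   / (qpoch q q n.+1 * qpoch (a * q * x ^+ 2) q n.+3 * qpoch (a * b * x) q n.+1 *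
    qpoch (q ^+ 2 * x / b) q n.+1 *
    qpoch (q ^+ 3 * x ^+ 2 / a) (q ^+ 2) n.+1)) * (- a) ^+ n); last by ring.
by rewrite normrM normrX normrN ler_wpM2r ?exprn_ge0.
Qed.

Hypothesis a1 : `|a| < 1.

Let a01 : 0 <= `|a| < 1. Proof. by rewrite normr_ge0. Qed.

Lemma watson_cvg x : watson_ok q a b x -> cvgn (series (watson_term q a b x)).
Proof.
move=> /watson_term_bound[c hc]; apply: (cvg_geom_series cmp gn _ c `|a|).
  by rewrite normr_id.
by move=> k; have := hc 0%N k; rewrite muln0 expr0 mul1r.
Qed.

Lemma watson_rem_cvg x : watson_ok q a b x -> watson_rem q a b x n @[n --> \oo] --> 0.
Proof.
move=> /watson_rem_bound[c hc]; apply: (@cvg_series_cvg_0 C C).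
by apply: (cvg_geom_series cmp gn _ c `|a|) => //; rewrite normr_id.
Qed.

(** The factor N may be zero, so this cannot be stated as the invariance of a
    quotient. *)
Lemma watson_iterate x n : watson_ok q a b x -> exists N,
  watson_den q a b x * watson_sum q a b x
  = N * (watson_den q a b (q ^+ (2 * n) * x) * watson_sum q a b (q ^+ (2 * n) * x))
  /\ watson_num q a b x = N * watson_num q a b (q ^+ (2 * n) * x).
Proof.
move=> ok; elim: n => [|n [N [hN1 hN2]]].
  by exists 1; rewrite muln0 expr0 !mul1r.
set y := q ^+ (2 * n) * x in hN1 hN2.
have oky : watson_ok q a b y by exact: watson_ok_shiftn.
have cy := watson_cvg _ (watson_ok_shift _ _ _ _ oky).
have [_ hy] := watson_sum_rec cmp gn q a b q1 a0 b0 y oky cy (watson_rem_cvg _ oky).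
exists (N * watson_num_ratio q a b y).
have -> : q ^+ (2 * n.+1) * x = q ^+ 2 * y by rewrite mulnS exprD mulrA.
by rewrite hN1 hy hN2 watson_num_rec // !mulrA.
Qed.

Let cvg_xn x : q ^+ (2 * n) * x @[n --> \oo] --> 0.
Proof.
under eq_fun do rewrite exprM.
by have := cvgnM _ _ _ _ (gn _ q2) (cvgn_cst x); rewrite mul0r; apply.
Qed.

Let cvg_mul (c : C) (f : C ^nat) : f n @[n --> \oo] --> 0 -> c * f n @[n --> \oo] --> 0.
Proof. by move=> hf; have := cvgnM _ _ _ _ (cvgn_cst c) hf; rewrite mulr0; apply. Qed.

Let cvg_sqr (f : C ^nat) : f n @[n --> \oo] --> 0 -> f n ^+ 2 @[n --> \oo] --> 0.
Proof. by move=> hf; have := cvgnM _ _ _ _ hf hf; rewrite mulr0; apply. Qed.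

Let cvg1M (f g : C ^nat) : f n @[n --> \oo] --> (1 : C) ->
  g n @[n --> \oo] --> (1 : C) -> f n * g n @[n --> \oo] --> (1 : C).
Proof. by move=> hf hg; have := cvgnM _ _ _ _ hf hg; rewrite mulr1; apply. Qed.

(** As the parameter tends to 0 only the terms of the q-binomial series
    survive. *)
Lemma watson_term_lim x k :
  watson_term q a b (q ^+ (2 * n) * x) k @[n --> \oo] -->
  qpoch (q / a) q k / qpoch q q k * (- a) ^+ k.
Proof.
have hx := cvg_xn x; have hx2 := cvg_sqr _ hx.
have e c : c * (q ^+ (2 * n) * x) ^+ 2 @[n --> \oo] --> 0 by exact: cvg_mul hx2.
have e' c : c * (q ^+ (2 * n) * x) @[n --> \oo] --> 0 by exact: cvg_mul hx.
have e'd c c' : c * (q ^+ (2 * n) * x) / c' @[n --> \oo] --> 0.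
  by have := cvgnM _ _ _ _ (e' c) (cvgn_cst (c'^-1)); rewrite mul0r; apply.
have ed c c' : c * (q ^+ (2 * n) * x) ^+ 2 / c' @[n --> \oo] --> 0.
  by have := cvgnM _ _ _ _ (e c) (cvgn_cst (c'^-1)); rewrite mul0r; apply.
rewrite /watson_term.
have h1 : 1 - q * (q ^+ (2 * n) * x) ^+ 2 * q ^+ (2 * k) @[n --> \oo] --> (1 : C).
  have := cvgB (cvgn_cst (1 : C)) (cvgnM _ _ _ _ (e q) (cvgn_cst (q ^+ (2 * k)))).
  by rewrite mul0r subr0; apply.
have num := cvgnM _ _ _ _ (cvgnM _ _ _ _ h1 (cvgnM _ _ _ _ (cvgnM _ _ _ _
  (cvgnM _ _ _ _ (cvgnM _ _ _ _ (cvg_qpoch_at0 _ q k (e q))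
  (cvgn_cst (qpoch (q / a) q k)))
  (cvg_qpoch_at0 _ q k (e'd (q ^+ 2) (a * b)))) (cvg_qpoch_at0 _ q k (e' b)))
  (cvg_qpoch_at0 _ (q ^+ 2) k (e (q * a))))) (cvgn_cst ((- a) ^+ k)).
have den := cvgnM _ _ _ _ (cvgnM _ _ _ _ (cvgnM _ _ _ _ (cvgnM _ _ _ _
  (cvgn_cst (qpoch q q k)) (cvg_qpoch_at0 _ q k (e (a * q))))
  (cvg_qpoch_at0 _ q k (e' (a * b)))) (cvg_qpoch_at0 _ q k (e'd (q ^+ 2) b)))
  (cvg_qpoch_at0 _ (q ^+ 2) k (ed (q ^+ 3) a)).
rewrite !(mul1r, mulr1) in num den.
have := cvgnM _ _ _ _ num (cvgnV _ _ (qpoch_neq0 qn k) den).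
by rewrite mulrAC; apply.
Qed.

Lemma watson_sum_lim x : watson_ok q a b x ->
  watson_sum q a b (q ^+ (2 * n) * x) @[n --> \oo] -->
  limn (series (fun k => qpoch (q / a) q k / qpoch q q k * (- a) ^+ k)).
Proof.
move=> ok; have [c hc] := watson_term_bound _ ok.
by have [_] := tannery cmp gn _ _ _ _ a01 hc (watson_term_lim x).
Qed.

Let le_mul2 n : (n <= 2 * n)%N. Proof. lia. Qed.
Let le_mul4 n : (n <= 4 * n)%N. Proof. lia. Qed.

Lemma watson_num_lim x : watson_num q a b (q ^+ (2 * n) * x) @[n --> \oo] --> (1 : C).
Proof.
rewrite /watson_num.
have h0 := cvg_qpoch_inf_sub cmp gn (q * x ^+ 2) _ _ q1 le_mul4.
have h c := cvg_qpoch_inf_sub cmp gn c _ _ q2 leqnn.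
have := cvg1M _ _ h0 (cvg1M _ _ (cvg1M _ _ (cvg1M _ _ (h (b * q * x))
   (h (q ^+ 3 * x / (a * b))))
   (h (a * q ^+ 2 * x / b))) (h (a ^+ 2 * b * x))).
move=> /eq_cvgn; apply => n; rewrite /watson_num.
have E : q ^+ (4 * n) = (q ^+ (2 * n)) ^+ 2.
  by rewrite -exprM; congr (_ ^+ _); lia.
have E2 : (q ^+ 2) ^+ n = q ^+ (2 * n) by rewrite exprM.
rewrite E E2; set y := q ^+ (2 * n).
have -> : q * x ^+ 2 * y ^+ 2 = q * (y * x) ^+ 2 by ring.
have -> : b * q * x * y = b * q * (y * x) by ring.
have -> : q ^+ 3 * x / (a * b) * y = q ^+ 3 * (y * x) / (a * b) by ring.
have -> : a * q ^+ 2 * x / b * y = a * q ^+ 2 * (y * x) / b by ring.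
have -> : a ^+ 2 * b * x * y = a ^+ 2 * b * (y * x) by ring.
reflexivity.
Qed.

Lemma watson_den_lim x : watson_den q a b (q ^+ (2 * n) * x) @[n --> \oo] --> (1 : C).
Proof.
have h c := cvg_qpoch_inf_sub cmp gn c _ _ q1 le_mul2.
have h' c := cvg_qpoch_inf_sub cmp gn c _ _ q2 le_mul2.
have := cvg1M _ _ (cvg1M _ _ (cvg1M _ _ (h (a * b * x)) (h (q ^+ 2 * x / b)))
   (h' (q ^+ 3 * x ^+ 2 / a))) (h' (a * q ^+ 2 * x ^+ 2)).
move=> /eq_cvgn; apply => n; rewrite /watson_den.
have E2 : (q ^+ 2) ^+ (2 * n) = (q ^+ (2 * n)) ^+ 2 by rewrite -!exprM mulnC.
rewrite E2; set y := q ^+ (2 * n).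
have -> : a * b * x * y = a * b * (y * x) by ring.
have -> : q ^+ 2 * x / b * y = q ^+ 2 * (y * x) / b by ring.
have -> : q ^+ 3 * x ^+ 2 / a * y ^+ 2 = q ^+ 3 * (y * x) ^+ 2 / a by ring.
have -> : a * q ^+ 2 * x ^+ 2 * y ^+ 2 = a * q ^+ 2 * (y * x) ^+ 2 by ring.
reflexivity.
Qed.

Lemma watson_sum_const x : watson_ok q a b x ->
  watson_den q a b x * watson_sum q a b x = watson_num q a b x
    * limn (series (fun k => qpoch (q / a) q k / qpoch q q k * (- a) ^+ k)).
Proof.
move=> ok.
have h1 := cvgnM _ _ _ _
  (cvgn_cst (watson_den q a b x * watson_sum q a b x)) (watson_num_lim x).
have h2 := cvgnM _ _ _ _ (cvgn_cst (watson_num q a b x))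
  (cvgnM _ _ _ _ (watson_den_lim x) (watson_sum_lim _ ok)).
rewrite mulr1 in h1; rewrite mul1r in h2.
rewrite -(cvg_lim (@norm_hausdorff _ _) h1) -(cvg_lim (@norm_hausdorff _ _) h2).
congr (limn _); apply/funext => n /=.
have [N [hA hB]] := watson_iterate _ n ok; exact: mul_cross hA hB.
Qed.

End WatsonNonterm.

Section WatsonFull.
Context {C : numClosedFieldType}.
Hypotheses (cmp : comparison_test C) (gn : geometric_null C).
Variables (q a : C).
Hypotheses (q0 : q != 0) (q1 : `|q| < 1) (a0 : a != 0).

Let q2 : `|q ^+ 2| < 1. Proof. by rewrite normrX expr_lt1. Qed.

(** The q-binomial series occurs for every b and x.  At b = x = 1 the q-Watson
    series reduces to its first term, which determines the value. *)
Lemma qbinomial_lim : `|a| < 1 -> nonvanishing a q ->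
  nonvanishing (q ^+ 3 / a) (q ^+ 2) ->
  limn (series (fun k => qpoch (q / a) q k / qpoch q q k * (- a) ^+ k))
    * (qpoch_inf q (q ^+ 2) * qpoch_inf (a ^+ 2) (q ^+ 2)) = qpoch_inf a q.
Proof.
move=> a1 an q3an; have qn := nonvanishing_small _ _ q1 q1.
have aqn : nonvanishing (a * q) q by have := nonvanishing_shift _ _ 1 an.
have ok : watson_ok q a 1 1.
  split; rewrite ?expr1n ?mulr1 ?divr1 //.
  by apply: nonvanishing_small => //; rewrite normrX expr_lt1.
have hS := watson_sum_const cmp gn q a 1 q0 q1 a0 (oner_neq0 _) a1 1 ok.
have [] := watson_sum_terminating cmp gn q a 1 q0 q1 a0 (oner_neq0 _) 0 1 ok.
  by rewrite expr0 !mulr1.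
rewrite hS => _; rewrite -mulrA mulrC => /mulIf; apply.
rewrite /watson_num ?expr1n ?mulr1 ?divr1 ?mul1r.
have aq2n : nonvanishing (a * q ^+ 2) (q ^+ 2).
  by move=> j; rewrite -exprM -mulrA -exprD.
rewrite !mulf_neq0 //; try exact: qpoch_inf_neq0.
  by apply: qpoch_inf_neq0 => // j; rewrite -exprM -exprS; have := qn (2 * j)%N; rewrite exprS.
apply: qpoch_inf_neq0 => //; apply: nonvanishing_small => //.
by rewrite normrX expr_lt1.
Qed.

(** Formula (II.16) in Gasper and Rahman's book, with lambda = q x^2. *)
Theorem watson_summation (b x : C) : b != 0 -> watson_ok q a b x ->
  [/\ `|a| < 1, nonvanishing a q & nonvanishing (q ^+ 3 / a) (q ^+ 2)]
    \/ (exists m, b * x * q ^+ m = 1) ->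
  cvgn (series (watson_term q a b x)) /\
  watson_den q a b x * watson_sum q a b x
    * (qpoch_inf q (q ^+ 2) * qpoch_inf (a ^+ 2) (q ^+ 2))
  = qpoch_inf a q * watson_num q a b x.
Proof.
move=> b0 ok [[a1 an q3an]|[m bx]]; last exact: watson_sum_terminating bx.
split; first exact: watson_cvg.
by rewrite watson_sum_const // -mulrA mulrC qbinomial_lim // mulrC.
Qed.

Lemma watson_term_swap (b x : C) k : b != 0 ->
  watson_term q a (q ^+ 2 / (a * b)) x k = watson_term q a b x k.
Proof.
move=> b0; rewrite /watson_term.
have -> : q ^+ 2 * x / (a * (q ^+ 2 / (a * b))) = b * x by field; rewrite ?q0 ?a0 ?b0.
have -> : q ^+ 2 / (a * b) * x = q ^+ 2 * x / (a * b) by rewrite mulrAC.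
have -> : a * (q ^+ 2 / (a * b)) * x = q ^+ 2 * x / b by field; rewrite ?q0 ?a0 ?b0.
have -> : q ^+ 2 * x / (q ^+ 2 / (a * b)) = a * b * x by field; rewrite ?q0 ?a0 ?b0.
set X1 := qpoch (b * x) q k; set X2 := qpoch (_ / (a * b)) q k.
set Y1 := qpoch (a * b * x) q k; set Y2 := qpoch (_ / b) q k.
congr (_ * _ * _ / _); [congr (_ * _)|congr (_ * _)]; exact: mulrAC.
Qed.

Lemma watson_ok_swap (b x : C) : b != 0 -> watson_ok q a b x ->
  watson_ok q a (q ^+ 2 / (a * b)) x.
Proof.
move=> b0 [h1 h2 h3 h4 h5]; split => //.
  by have -> : a * (q ^+ 2 / (a * b)) * x = q ^+ 2 * x / b by field; rewrite ?q0 ?a0 ?b0.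
by have -> : q ^+ 2 * x / (q ^+ 2 / (a * b)) = a * b * x by field; rewrite ?q0 ?a0 ?b0.
Qed.

End WatsonFull.

(** * Interchanging the two summations *)

Definition bailey_delta {C : numClosedFieldType} (q a b : C) (N : nat) : C :=
  (1 - q ^+ (2 * N).+1) / (1 - q)
  * (qpoch (q ^+ 2 / (a * b)) q N * qpoch b q N * qpoch (q * a) (q ^+ 2) N)
  / (qpoch (a * b) q N * qpoch (q ^+ 2 / b) q N * qpoch (q ^+ 3 / a) (q ^+ 2) N)
  * (- a) ^+ N.

(** Up to the prefactor and (-a)^M, the sum over N of the weights delta_N
    against the kernel. *)
Definition bailey_gamma {C : numClosedFieldType} (q a b : C) (M : nat) : C :=
  qpoch (q ^+ 2 / (a * b)) q M * qpoch b q M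
  * (qpoch_inf (b * q ^+ M.+1) (q ^+ 2)
     * qpoch_inf (q ^+ (M + 3) / (a * b)) (q ^+ 2)
     * qpoch_inf (a * q ^+ (M + 2) / b) (q ^+ 2)
     * qpoch_inf (a ^+ 2 * b * q ^+ M) (q ^+ 2)).

Definition bailey_prefactor {C : numClosedFieldType} (q a b : C) : C :=
  qpoch_inf (a * b) q * qpoch_inf (q ^+ 2 / b) q
  * (qpoch_inf q (q ^+ 2) * qpoch_inf (q ^+ 3 / a) (q ^+ 2)
     * qpoch_inf (q ^+ 2 * a) (q ^+ 2) * qpoch_inf (a ^+ 2) (q ^+ 2))
  / (qpoch_inf (q ^+ 2) q * qpoch_inf a q).

Lemma sum_triangle {V : nmodType} (f : nat -> nat -> V) K :
  \sum_(N < K) \sum_(M < N.+1) f N M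
  = \sum_(M < K) \sum_(k < K - M) f (M + k)%N M.
Proof.
elim: K => [|K IHK]; first by rewrite !big_ord0.
rewrite big_ord_recr IHK /= [in RHS]big_ord_recr /= subSnn big_ord1 addn0.
rewrite [X in _ + X]big_ord_recr /= addrA -big_split /=; congr (_ + _).
apply: eq_bigr => M _; rewrite subSn; last exact: ltnW.
by rewrite big_ord_recr /= subnKC // ltnW.
Qed.

Section Bailey.
Context {C : numClosedFieldType}.
Hypotheses (cmp : comparison_test C) (gn : geometric_null C).
Variables (q a b d : C).
Hypotheses (q0 : q != 0) (a0 : a != 0) (b0 : b != 0) (d0 : d != 0).
Hypothesis q1 : `|q| < 1.
Hypotheses (an : nonvanishing a q) (abn : nonvanishing (a * b) q)
  (qbn : nonvanishing (q ^+ 2 / b) q) (qan : nonvanishing (q ^+ 3 / a) (q ^+ 2))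
  (adn : nonvanishing (a * d) q) (aqdn : nonvanishing (a * q / d) q).
Hypothesis small_or_stops : `|a| < 1 \/
  exists l, b * q ^+ l = 1 \/ q ^+ 2 / (a * b) * q ^+ l = 1.

Let q2 : `|q ^+ 2| < 1. Proof. by rewrite normrX expr_lt1. Qed.
Let qn : nonvanishing q q. Proof. exact: nonvanishing_small. Qed.
Let q2n : nonvanishing (q ^+ 2) (q ^+ 2). Proof. exact: nonvanishing_small. Qed.
Let aqn : nonvanishing (a * q) q. Proof. exact: (nonvanishing_shift _ _ 1). Qed.
Let q2qn : nonvanishing (q ^+ 2) q. Proof. exact: nonvanishing_small. Qed.

Let D := bailey_delta q a b.
Let K := wp_kernel q a.

Lemma watson_ok_qX M : watson_ok q a b (q ^+ M).
Proof.
split.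
- by rewrite -exprM; exact: nonvanishing_shift.
- by rewrite -exprM; exact: nonvanishing_shift.
- exact: nonvanishing_shift.
- by rewrite mulrAC; exact: nonvanishing_shift.
- rewrite -exprM mulnC exprM mulrAC; exact: nonvanishing_shift.
Qed.

(** The part of delta_N K(N, M) with N = M + k that does not depend on k. *)
Definition bailey_coef M : C :=
  qpoch (q ^+ 2 / (a * b)) q M * qpoch b q M * qpoch (q * a) (q ^+ 2) M
  / (qpoch (a * b) q M * qpoch (q ^+ 2 / b) q M * qpoch (q ^+ 3 / a) (q ^+ 2) M)
  * (- a) ^+ M * qpoch q q (M + M) / ((1 - q) * qpoch (a * q) q (M + M)).

Lemma delta_kernel M k :
  D (M + k)%N * K (M + k)%N M = bailey_coef M * watson_term q a b (q ^+ M) k.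
Proof.
rewrite /D /K /bailey_delta /wp_kernel /bailey_coef /watson_term.
rewrite addKn addnAC.
rewrite (qpochD (q ^+ 2 / (a * b))) (qpochD b) (qpochD (q * a)) (qpochD (a * b)).
rewrite (qpochD (q ^+ 2 / b)) (qpochD (q ^+ 3 / a)) (qpochD q q (M + M)).
rewrite (qpochD (a * q) q (M + M)).
have hq : 1 - q != 0 by have := qn 0%N; rewrite expr0 mulr1.
have := qpoch_neq0 abn M; have := qpoch_neq0 (nonvanishing_shift _ _ M abn) k.
have := qpoch_neq0 qbn M; have := qpoch_neq0 (nonvanishing_shift _ _ M qbn) k.
have := qpoch_neq0 qan M; have := qpoch_neq0 (nonvanishing_shift _ _ M qan) k.
have := qpoch_neq0 aqn (M + M); have := qpoch_neq0 (nonvanishing_shift _ _ (M + M) aqn) k.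
have := qpoch_neq0 qn k.
have -> : (q ^+ 2) ^+ M = (q ^+ M) ^+ 2 by rewrite exprAC.
have -> : q ^+ (2 * (M + k)).+1 = q * (q ^+ M) ^+ 2 * q ^+ (2 * k).
  by rewrite exprS mulnDr exprD (mulnC 2%N M) exprM mulrA.
have -> : q ^+ (M + M) = (q ^+ M) ^+ 2 by rewrite exprD expr2.
rewrite (exprD (- a)); set x := q ^+ M.
have -> : q ^+ 2 / (a * b) * x = q ^+ 2 * x / (a * b) by ring.
have -> : q ^+ 2 / b * x = q ^+ 2 * x / b by ring.
have -> : q ^+ 3 / a * x ^+ 2 = q ^+ 3 * x ^+ 2 / a by ring.
move: hq ((- a) ^+ M) ((- a) ^+ k) => + s1 s2.
atoms.
by move=> *; field; repeat (apply/andP; split => //).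
Qed.

(** If b q^l = 1 or q^2/(ab) q^l = 1, the q-Watson series at x = q^M terminates
    for M <= l; for M > l it need not converge, but then all weights delta_N with
    N >= M are zero.  The second alternative reduces to the first, since b and
    q^2/(ab) play symmetric roles. *)
Let watson_or_zero M : cvgn (series (watson_term q a b (q ^+ M))) /\
  watson_den q a b (q ^+ M) * watson_sum q a b (q ^+ M)
    * (qpoch_inf q (q ^+ 2) * qpoch_inf (a ^+ 2) (q ^+ 2))
  = qpoch_inf a q * watson_num q a b (q ^+ M)
  \/ qpoch b q M = 0 \/ qpoch (q ^+ 2 / (a * b)) q M = 0.
Proof.
have ok := watson_ok_qX M.
have [lt|[l]] := small_or_stops; first by left; apply: watson_summation => //; left.
have vanish y : y * q ^+ l = 1 -> (l < M)%N -> qpoch y q M = 0.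
  by move=> e lM; rewrite -(subnKC lM) qpochD qpochS e subrr mulr0 mul0r.
have [lM|Ml] := ltnP l M; first by move=> [e|e]; right; [left|right]; exact: vanish.
have shift y : y * q ^+ l = 1 -> y * q ^+ M * q ^+ (l - M) = 1.
  by rewrite -mulrA -exprD subnKC.
move=> [/shift e|/shift e]; left.
  by apply: watson_summation => //; right; exists (l - M)%N.
have b'0 : q ^+ 2 / (a * b) != 0.
  by rewrite mulf_neq0 ?invr_eq0 ?mulf_neq0 ?expf_neq0.
have [] := watson_summation cmp gn q a q0 q1 a0 (q ^+ 2 / (a * b)) (q ^+ M) b'0
  (watson_ok_swap q a q0 a0 b (q ^+ M) b0 ok) (or_intror (ex_intro _ _ e)).
rewrite /watson_sum (_ : watson_term q a (q ^+ 2 / (a * b)) (q ^+ M)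
  = watson_term q a b (q ^+ M)); last first.
  by apply/funext => k; exact: watson_term_swap.
move=> c e'; split=> //; move: e'; rewrite /watson_den /watson_num.
set x := q ^+ M; set S := limn _.
have -> : a * (q ^+ 2 / (a * b)) * x = q ^+ 2 * x / b by field; rewrite ?q0 ?a0 ?b0.
have -> : q ^+ 2 * x / (q ^+ 2 / (a * b)) = a * b * x by field; rewrite ?q0 ?a0 ?b0.
have -> : q ^+ 2 / (a * b) * q * x = q ^+ 3 * x / (a * b) by ring.
have -> : q ^+ 3 * x / (a * (q ^+ 2 / (a * b))) = b * q * x by field; rewrite ?q0 ?a0 ?b0.
have -> : a * q ^+ 2 * x / (q ^+ 2 / (a * b)) = a ^+ 2 * b * x by field; rewrite ?q0 ?a0 ?b0.
have -> : a ^+ 2 * (q ^+ 2 / (a * b)) * x = a * q ^+ 2 * x / b by field; rewrite ?q0 ?a0 ?b0.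
move: S; repeat match goal with
  | |- context [qpoch_inf ?u ?v] => move: (qpoch_inf u v) => ? end.
by move=> S e'; etransitivity; [etransitivity; [|exact: e']|]; ring.
Qed.

Lemma coef_gamma M S :
  watson_den q a b (q ^+ M) * S
    * (qpoch_inf q (q ^+ 2) * qpoch_inf (a ^+ 2) (q ^+ 2))
  = qpoch_inf a q * watson_num q a b (q ^+ M) ->
  bailey_prefactor q a b * (bailey_coef M * S) = (- a) ^+ M * bailey_gamma q a b M.
Proof.
rewrite /watson_den /watson_num /bailey_prefactor /bailey_coef /bailey_gamma.
have -> : b * q ^+ M.+1 = b * q * q ^+ M by rewrite exprS mulrA.
have -> : q ^+ (M + 3) / (a * b) = q ^+ 3 * q ^+ M / (a * b) by rewrite addnC exprD.
have -> : a * q ^+ (M + 2) / b = a * q ^+ 2 * q ^+ M / b by rewrite addnC exprD mulrA.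
have Q2 : qpoch_inf (q ^+ 2) q
    = qpoch q q (M + M) * qpoch_inf (q * (q ^+ M) ^+ 2) q / (1 - q).
  have hq : 1 - q != 0 by have := qn 0%N; rewrite expr0 mulr1.
  rewrite -exprM muln2 -addnn -(qpoch_infD cmp gn q q1 q) (qpoch_infD cmp gn q q1 q 1).
  by rewrite qpoch1 expr1 -expr2 mulrAC mulfV // mul1r.
have := qpoch_inf_neq0 cmp gn q q1 _ q2qn; rewrite Q2.
rewrite (qpoch_infD cmp gn q q1 (a * b) M) (qpoch_infD cmp gn q q1 (q ^+ 2 / b) M).
rewrite (qpoch_infD cmp gn _ q2 (q ^+ 3 / a) M) (qpoch_infD cmp gn _ q2 (q ^+ 2 * a) M).
have -> : qpoch (a * q) q (M + M) = qpoch (q * a) (q ^+ 2) M * qpoch (q ^+ 2 * a) (q ^+ 2) M.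
  by rewrite addnn qpoch_split -mulrA -expr2 (mulrC a q) (mulrC a).
have -> : (q ^+ 2) ^+ M = (q ^+ M) ^+ 2 by rewrite exprAC.
have Aneq := qpoch_inf_neq0 cmp gn q q1 _ an.
have aq2n : nonvanishing (q ^+ 2 * a) (q ^+ 2).
  move=> j; rewrite (_ : _ * _ = a * q ^+ (2 + 2 * j)) //.
  by rewrite exprD exprM; ring.
have aqn' : nonvanishing (q * a) (q ^+ 2).
  move=> j; rewrite (_ : _ * _ = a * q ^+ (1 + 2 * j)) //.
  by rewrite exprD exprM; ring.
have := qpoch_neq0 abn M; have := qpoch_neq0 qbn M; have := qpoch_neq0 qan M.
have := qpoch_neq0 aq2n M; have := qpoch_neq0 aqn' M.
have : 1 - q != 0 by have := qn 0%N; rewrite expr0 mulr1.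
move: Aneq; set x := q ^+ M.
have -> : q ^+ 2 / b * x = q ^+ 2 * x / b by ring.
have -> : q ^+ 3 / a * x ^+ 2 = q ^+ 3 * x ^+ 2 / a by ring.
have -> : q ^+ 2 * a * x ^+ 2 = a * q ^+ 2 * x ^+ 2 by ring.
have [X] : exists X, X = (- a) ^+ M * (qpoch (q ^+ 2 / (a * b)) q M * qpoch b q M)
    / (qpoch_inf a q * qpoch_inf (q * x ^+ 2) q) by eexists.
move: ((- a) ^+ M) (1 - q) => s1 s2.
repeat match goal with
  | |- context [qpoch ?u ?v ?n] => move: (qpoch u v n) => ?
  | |- context [qpoch_inf ?u ?v] => move: (qpoch_inf u v) => ? end.
move=> hX h1 h2 h3 h4 h5 h6 h7; rewrite !mulf_eq0 !negb_or invr_eq0.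
move=> /andP[/andP[h8 h9] _] /(congr1 ( *%R X)) e.
etransitivity; [etransitivity; [|exact: e]|]; rewrite hX; field;
  repeat (apply/andP; split => //).
Qed.

Lemma gamma_lim M : exists2 s,
  series (fun k => D (M + k)%N * K (M + k)%N M) n @[n --> \oo] --> s
  & bailey_prefactor q a b * s = (- a) ^+ M * bailey_gamma q a b M.
Proof.
have [[c e]|z] := watson_or_zero M.
  exists (bailey_coef M * watson_sum q a b (q ^+ M)); last exact: coef_gamma.
  apply: eq_cvgn (cvgnM _ _ _ _ (cvgn_cst (bailey_coef M)) c) _ => n.
  by rewrite /series /= mulr_sumr; apply: eq_bigr => k _; rewrite delta_kernel.
exists 0.
  apply: eq_cvgn (cvgn_cst 0) _ => n; rewrite /series /= big1 // => k _.
  by rewrite /D /bailey_delta !qpochD; case: z => ->; rewrite !(mul0r, mulr0).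
by rewrite /bailey_gamma; case: z => ->; rewrite !(mul0r, mulr0).
Qed.

(** For |a| < 1 the weights decay like a^N.  In the terminating case only
    finitely many of them are nonzero and any ratio does, here 1/2. *)
Lemma delta_bound : exists c r,
  [/\ 0 <= c, 0 <= r < 1 & forall N, `|D N| <= c * r ^+ N].
Proof.
have [lt|[l hl]] := small_or_stops.
  have : unif_bounded (fun N (_ : nat) =>
      (1 - q * q ^+ (2 * N)) * (1 - q)^-1
      * (qpoch (q ^+ 2 / (a * b) * q ^+ 0) q N * qpoch (b * q ^+ 0) q N
         * qpoch (q * a * (q ^+ 2) ^+ 0) (q ^+ 2) N)
      * ((qpoch (a * b * q ^+ 0) q N)^-1 * (qpoch (q ^+ 2 / b * q ^+ 0) q N)^-1
         * (qpoch (q ^+ 3 / a * (q ^+ 2) ^+ 0) (q ^+ 2) N)^-1)).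
    do ?[apply: unif_boundedM]; try exact: unif_bounded_cst;
    try exact: (unif_bounded_factor _ _ (fun n _ => 2 * n)%N q1);
    try exact: (unif_bounded_qpoch gn _ _ (fun _ _ => 0%N) (fun n _ => n));
    try exact: (unif_bounded_qpochV gn _ _ (fun _ _ => 0%N) (fun n _ => n)).
  move=> [c hc]; exists c, `|a|; split=> [||N]; last 1 first.
  - have := hc N 0%N; rewrite !expr0 !mulr1 -!invfM /D /bailey_delta (exprS q (2 * N)) => h.
    by rewrite normrM normrX normrN ler_wpM2r ?exprn_ge0.
  - exact: le_trans (normr_ge0 _) (hc 0%N 0%N).
  - by rewrite normr_ge0.
have vanish N : (l < N)%N -> D N = 0.
  move=> lN; have v y : y * q ^+ l = 1 -> qpoch y q N = 0.
    by move=> e; rewrite -(subnKC lN) qpochD qpochS e subrr mulr0 mul0r.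
  by rewrite /D /bailey_delta; case: hl => /v ->; rewrite !(mul0r, mulr0).
have h2 : (0 : C) < 2%:R^-1 by rewrite invr_gt0 ltr0n.
exists (\sum_(N < l.+1) (`|D N| * 2%:R ^+ N : C)), 2%:R^-1; split.
- by apply: sumr_ge0 => N _; rewrite mulr_ge0 // exprn_ge0 // ler0n.
- by rewrite ltW //= invf_lt1 ?ltr0n // ltr1n.
move=> N; have [lN|Nl] := ltnP l N.
  rewrite vanish // normr0; apply: mulr_ge0; last by rewrite exprn_ge0 // ltW.
  by apply: sumr_ge0 => i _; rewrite mulr_ge0 // exprn_ge0 // ler0n.
rewrite exprVn ler_pdivlMr ?exprn_gt0 ?ltr0n //.
have Nl' : (N < l.+1)%N by [].
rewrite (bigD1 (Ordinal Nl')) //= lerDl.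
by apply: sumr_ge0 => i _; rewrite mulr_ge0 // exprn_ge0 // ler0n.
Qed.

Lemma kernel_bound : exists c, forall N M, `|K N M| <= c.
Proof.
have : unif_bounded (fun N M =>
    qpoch (q * q ^+ 0) q (N + M) * qpoch (q / a * q ^+ 0) q (N - M)
    * ((qpoch (q * q ^+ 0) q (N - M))^-1 * (qpoch (a * q * q ^+ 0) q (N + M))^-1)).
  do ?[apply: unif_boundedM];
    try exact: (unif_bounded_qpoch gn _ _ (fun _ _ => 0%N) (fun n m => n + m)%N);
    try exact: (unif_bounded_qpoch gn _ _ (fun _ _ => 0%N) (fun n m => n - m)%N);
    try exact: (unif_bounded_qpochV gn _ _ (fun _ _ => 0%N) (fun n m => n + m)%N);
    try exact: (unif_bounded_qpochV gn _ _ (fun _ _ => 0%N) (fun n m => n - m)%N).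
move=> [c hc]; exists c => N M; have := hc N M.
by rewrite expr0 !mulr1 -invfM.
Qed.

Lemma alpha_bound : exists c, forall M, `|wp_alpha q a d M * (-1) ^+ M| <= c.
Proof.
have : unif_bounded (fun M (_ : nat) =>
    (1 - a * q ^+ (2 * M)) * (1 - a)^-1
    * (qpoch (a ^+ 2 * (q ^+ 2) ^+ 0) (q ^+ 2) M * qpoch (d * q ^+ 0) q M
       * qpoch (q / d * q ^+ 0) q M)
    * ((qpoch (q ^+ 2 * (q ^+ 2) ^+ 0) (q ^+ 2) M)^-1
       * (qpoch (a * d * q ^+ 0) q M)^-1 * (qpoch (a * q / d * q ^+ 0) q M)^-1)).
  do ?[apply: unif_boundedM]; try exact: unif_bounded_cst;
    try exact: (unif_bounded_factor _ _ (fun n _ => 2 * n)%N q1);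
    try exact: (unif_bounded_qpoch gn _ _ (fun _ _ => 0%N) (fun n _ => n));
    try exact: (unif_bounded_qpochV gn _ _ (fun _ _ => 0%N) (fun n _ => n)).
move=> [c hc]; exists c => M; have := hc M 0%N.
rewrite !expr0 !mulr1 -!invfM => h.
by rewrite normrM normrX normrN1 expr1n mulr1.
Qed.

(** The partial sums over N < n are sums over the triangle M <= N < n.  Summed
    over N first, their M-th row is dominated by a geometric sequence in M,
    uniformly in n, so that Tannery's theorem applies. *)
Lemma bailey_sum :
  exists2 s, \sum_(N < n) D N * (\sum_(M < N.+1) wp_alpha q a d M * (-1) ^+ M * K N M)
               @[n --> \oo] --> s
  & series (fun M => wp_alpha q a d M * a ^+ M * bailey_gamma q a b M) n @[n --> \oo]
      --> bailey_prefactor q a b * s.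
Proof.
pose A M := wp_alpha q a d M * (-1) ^+ M.
have [s hs hsg] : exists2 s : C ^nat,
   (forall M, series (fun k => D (M + k)%N * K (M + k)%N M) n @[n --> \oo] --> s M)
   & (forall M, bailey_prefactor q a b * s M = (- a) ^+ M * bailey_gamma q a b M).
  have /choice[s h] : forall M, exists s,
    series (fun k => D (M + k)%N * K (M + k)%N M) n @[n --> \oo] --> s /\
    bailey_prefactor q a b * s = (- a) ^+ M * bailey_gamma q a b M.
    by move=> M; have [s] := gamma_lim M; exists s.
  by exists s => M; have [] := h M.
have [c1 [r [c10 r01 hD]]] := delta_bound; have /andP[r0 r1] := r01.
have [c2 hK] := kernel_bound; have [c3 hA] := alpha_bound.
pose u n M := if (M < n)%N then A M * \sum_(k < n - M) D (M + k)%N * K (M + k)%N M else 0.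
have c20 : 0 <= c2 := le_trans (normr_ge0 _) (hK 0%N 0%N).
have c30 : 0 <= c3 := le_trans (normr_ge0 _) (hA 0%N).
have r1' : 0 < 1 - r by rewrite subr_gt0.
have ub n M : `|u n M| <= c3 * (c1 * c2 / (1 - r)) * r ^+ M.
  rewrite /u; case: ifP => _; last first.
    by rewrite normr0 !mulr_ge0 ?invr_ge0 ?exprn_ge0 // ltW.
  rewrite normrM -mulrA ler_pM //; first exact: hA.
  apply: (@le_trans _ _ (\sum_(k < n - M) c1 * c2 * r ^+ M * r ^+ k)).
    apply: le_trans (ler_norm_sum _ _ _) _; apply: ler_sum => k _.
    rewrite normrM; apply: le_trans (ler_pM _ _ (hD _) (hK _ _)) _ => //.
    by rewrite exprD le_eqVlt; apply/orP; left; apply/eqP; ring.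
  rewrite -mulr_sumr [leRHS]mulrAC; apply: ler_wpM2l.
    by rewrite !mulr_ge0 ?exprn_ge0.
  rewrite -[leRHS]mul1r ler_pdivlMr // -(big_mkord predT (fun k => r ^+ k)).
  by rewrite /index_iota subn0 sum_geom expr0 gerBl exprn_ge0.
have uE n M : (M < n)%N ->
    u n M = A M * series (fun k => D (M + k)%N * K (M + k)%N M) (n - M)%N.
  by move=> Mn; rewrite /u Mn /series /= big_mkord.
have ulim M : u n M @[n --> \oo] --> A M * s M.
  rewrite -(cvg_shiftn M.+1).
  rewrite (_ : [sequence _]_n = (fun n => A M *
      series (fun k => D (M + k)%N * K (M + k)%N M) (n + 1)%N)).
    by apply: cvgnM; [exact: cvgn_cst|have := hs M; rewrite -(cvg_shiftn 1)].
  apply/funext => n; transitivity (u (n + M.+1)%N M); first by [].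
  have Mn : (M < n + M.+1)%N by rewrite addnS ltnS leq_addl.
  by rewrite uE // addnS -addSn addnK addn1.
have [cv lim_u] := tannery cmp gn _ _ _ _ r01 ub ulim.
exists (limn (series (fun M => A M * s M))).
  apply: eq_cvgn lim_u _ => n.
  have stop : forall k, (n <= k)%N -> u n k = 0.
    by move=> k nk; rewrite /u ltnNge nk.
  rewrite (cvg_lim (@norm_hausdorff _ _) (cvg_series_stop _ _ stop)).
  rewrite /series /= big_mkord.
  under [in RHS]eq_bigr => N _ do rewrite mulr_sumr.
  rewrite (sum_triangle (fun N M => D N * (wp_alpha q a d M * (-1) ^+ M * K N M))).
  apply: eq_bigr => M _; rewrite /u ltn_ord mulr_sumr; apply: eq_bigr => k _.
  by rewrite /A mulrCA.
apply: eq_cvgn (cvgnM _ _ _ _ (cvgn_cst (bailey_prefactor q a b)) cv) _ => n.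
rewrite /series /= mulr_sumr; apply: eq_bigr => M _.
rewrite mulrCA hsg /A mulrA -[RHS]mulrA -[wp_alpha _ _ _ _ * _ * _]mulrA -exprMn.
by rewrite mulN1r opprK mulrA.
Qed.
End Bailey.

(** * The four series as even and odd parts *)

Lemma vwp_factor {C : numClosedFieldType} (x q : C) n :
  nonvanishing x q -> qpoch (q * x) q n / qpoch x q n = (1 - x * q ^+ n) / (1 - x).
Proof.
move=> h; have := qpoch_neq0 h n; have := h 0%N; rewrite expr0 mulr1 => h1 h2.
by apply/eqP; rewrite eqr_div // mulrC (mulrC q) -qpochSl qpochS mulrC.
Qed.

Lemma W_termE {C : numClosedFieldType} (a1 : C) (s : seq C) (p x : C) n :
  no_zero_factor (W_den a1 s p) p ->
  W_term a1 s p x n = (1 - a1 * p ^+ (2 * n)) / (1 - a1)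
    * (qpoch a1 p n * qpochs s p n)
    / (qpoch p p n * qpochs [seq a1 * p / y | y <- s] p n) * x ^+ n.
Proof.
move=> h; rewrite /W_term /W_num /W_den /qpochs !big_cons.
have hr : nonvanishing (sqrtC a1) p by apply: h; rewrite !inE eqxx !orbT.
have hr' : nonvanishing (- sqrtC a1) p by apply: h; rewrite !inE eqxx !orbT.
have e1 := vwp_factor _ _ n hr; have e2 := vwp_factor _ _ n hr'.
have -> : (1 - a1 * p ^+ (2 * n)) / (1 - a1)
  = (1 - sqrtC a1 * p ^+ n) / (1 - sqrtC a1)
    * ((1 - - sqrtC a1 * p ^+ n) / (1 - - sqrtC a1)).
  by rewrite mulf_div -{1 2}(sqrtCK a1) mulnC exprM; congr (_ / _); ring.
rewrite -e1 -e2 mulrN; congr (_ * _); rewrite !invfM; ring.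
Qed.

Lemma W_numE {C : numClosedFieldType} (a1 : C) (s : seq C) (p : C) y :
  (y \in W_num a1 s p) = [|| y == a1, y == p * sqrtC a1, y == - (p * sqrtC a1) | y \in s].
Proof. by rewrite /W_num !inE. Qed.

Section Terminates.
Context {C : numClosedFieldType}.
Hypotheses (cmp : comparison_test C) (gn : geometric_null C).

Lemma qpochs_ge (s : seq C) p : `|p| < 1 -> no_zero_factor s p ->
  exists2 c, 0 < c & forall n, c <= `|qpochs s p n|.
Proof.
move=> p1; elim: s => [|y s IHs] h.
  by exists 1 => // n; rewrite /qpochs big_nil normr1.
have [c c0 hc] : exists2 c, 0 < c & forall n, c <= `|qpochs s p n|.
  by apply: IHs => z zs; apply: h; rewrite inE zs orbT.
have [e e0 he] := qpoch_ge gn p p1 y (h y (mem_head _ _)).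
exists (e * c) => [|n]; first exact: mulr_gt0.
rewrite /qpochs big_cons normrM; apply: ler_pM; [exact: ltW|exact: ltW| |exact: hc].
by have := he 0%N n; rewrite expr0 mulr1.
Qed.

Lemma qpochs_le (s : seq C) p : `|p| < 1 ->
  exists2 M, 0 < M & forall n, `|qpochs s p n| <= M.
Proof.
move=> p1; elim: s => [|y s [M M0 hM]].
  by exists 1 => // n; rewrite /qpochs big_nil normr1.
have [N N0 hN] := qpoch_le gn p p1 _ (normr_ge0 y).
exists (N * M) => [|n]; first exact: mulr_gt0.
rewrite /qpochs big_cons normrM; apply: ler_pM => //; first exact: hN.
exact: hM.
Qed.

(** Otherwise the numerators are bounded away from 0 and the denominators are
    bounded, so that for |x| >= 1 the terms do not tend to 0. *)
Lemma W_terminates (a1 : C) (s : seq C) (p x : C) : `|p| < 1 -> ~~ (`|x| < 1) ->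
  W_admissible a1 s p x ->
  exists2 y, y \in W_num a1 s p & exists j, y * p ^+ j = 1.
Proof.
move=> p1 x1 [hd /cvg_series_cvg_0 hc]; apply: contrapT => nex.
have hn : no_zero_factor (W_num a1 s p) p.
  move=> y ys j; apply/eqP => /eqP; rewrite subr_eq0 => /eqP e.
  by apply: nex; exists y => //; exists j.
have [c c0 hnum] := qpochs_ge _ _ p1 hn.
have [M M0 hden] := qpochs_le (W_den a1 s p) _ p1.
have x1' : 1 <= `|x| by rewrite real_leNgt ?ger0_real.
move/cvgrPdist_lt: hc => /(_ _ (divr_gt0 c0 M0))[n _ /(_ n (leqnn n))] /=.
rewrite sub0r normrN normr_id => lt.
suff ge : c / M <= `|W_term a1 s p x n| by have := le_lt_trans ge lt; rewrite ltxx.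
rewrite /W_term normrM normrX -[c / M]mulr1; apply: ler_pM => //.
- by rewrite divr_ge0 // ltW.
- rewrite normrM normfV; apply: ler_pM => //; first exact: ltW.
    by rewrite invr_ge0 ltW.
  rewrite lef_pV2 ?posrE ?hden // normr_gt0.
  by rewrite /qpochs prodf_seq_neq0; apply/allP => y ys; apply: qpoch_neq0; exact: hd.
- by rewrite exprn_ege1.
Qed.
End Terminates.

Lemma qpochs_nil {C : numClosedFieldType} (q : C) n : qpochs [::] q n = 1.
Proof. by rewrite /qpochs big_nil. Qed.

Lemma qpochs_cons {C : numClosedFieldType} (x : C) s q n :
  qpochs (x :: s) q n = qpoch x q n * qpochs s q n.
Proof. by rewrite /qpochs big_cons. Qed.

Section Terms.
Context {C : numClosedFieldType}.
Variables (q a b d : C).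
Hypotheses (q0 : q != 0) (a0 : a != 0) (b0 : b != 0) (d0 : d != 0).
Hypothesis q1 : `|q| < 1.
Hypotheses (an : nonvanishing a q) (abn : nonvanishing (a * b) q)
  (qbn : nonvanishing (q ^+ 2 / b) q) (qan : nonvanishing (q ^+ 3 / a) (q ^+ 2))
  (adn : nonvanishing (a * d) q) (aqdn : nonvanishing (a * q / d) q).

Let q2 : `|q ^+ 2| < 1. Proof. by rewrite normrX expr_lt1. Qed.
Let qn : nonvanishing q q. Proof. exact: nonvanishing_small. Qed.
Let q2n : nonvanishing (q ^+ 2) (q ^+ 2). Proof. exact: nonvanishing_small. Qed.
Let qq2n : nonvanishing q (q ^+ 2). Proof. exact: nonvanishing_small. Qed.
Let q3q2n : nonvanishing (q ^+ 3) (q ^+ 2).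
Proof. by apply: nonvanishing_small => //; rewrite normrX expr_lt1. Qed.

Let sum_alpha N := \sum_(M < N.+1) wp_alpha q a d M * (-1) ^+ M * wp_kernel q a N M.

(** Symbols with base q and length 2n split into two symbols with base q^2, and
    the square roots combine by (x)(-x) = (x^2). *)
Lemma W_term1 n :
  let s := [:: q ^+ 2 / (a * b); q ^+ 3 / (a * b); b; b * q;
         sqrtC (q * a); - sqrtC (q * a);
         sqrtC (q ^+ 3 * a); - sqrtC (q ^+ 3 * a);
         q ^+ 2 / (a * d); q * d / a; q ^+ 2] in
  no_zero_factor (W_den q s (q ^+ 2)) (q ^+ 2) ->
  W_term q s (q ^+ 2) (a ^+ 2) n = bailey_delta q a b n.*2 * sum_alpha n.*2.
Proof.
move=> s h; rewrite W_termE // /sum_alpha wp_sum_even //.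
rewrite /s /= !qpochs_cons !qpochs_nil /bailey_delta !qpoch_split.
have sqa0 : sqrtC (q * a) != 0 by rewrite sqrtC_eq0 mulf_neq0.
have sq3a0 : sqrtC (q ^+ 3 * a) != 0 by rewrite sqrtC_eq0 mulf_neq0 ?expf_neq0.
have -> : q * q ^+ 2 / (q ^+ 2 / (a * b)) = a * b * q by field; rewrite ?q0 ?a0 ?b0.
have -> : q * q ^+ 2 / (q ^+ 3 / (a * b)) = a * b by field; rewrite ?q0 ?a0 ?b0.
have -> : q * q ^+ 2 / (b * q) = q ^+ 2 / b by field; rewrite ?q0 ?a0 ?b0.
have -> : q * q ^+ 2 / b = q ^+ 2 / b * q by ring.
have -> : q * q ^+ 2 / (q ^+ 2 / (a * d)) = q * a * d by field; rewrite ?q0 ?a0 ?d0.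
have -> : q * q ^+ 2 / (q * d / a) = q ^+ 2 * a / d by field; rewrite ?q0 ?a0 ?d0.
have -> : q * q ^+ 2 / (q ^+ 2) = q by field.
have -> : q ^+ 3 / (a * b) = q ^+ 2 / (a * b) * q by ring.
rewrite !invrN !mulrN.
set r := sqrtC (q * a); set t := sqrtC (q ^+ 3 * a).
have r2 : r ^+ 2 = q * a by rewrite sqrtCK.
have t2 : t ^+ 2 = q ^+ 3 * a by rewrite sqrtCK.
have -> : qpoch (q * a) ((q ^+ 2) ^+ 2) n = qpoch r (q ^+ 2) n * qpoch (- r) (q ^+ 2) n.
  by rewrite qpoch_pm r2.
have -> : qpoch (q * a * q ^+ 2) ((q ^+ 2) ^+ 2) n
    = qpoch t (q ^+ 2) n * qpoch (- t) (q ^+ 2) n.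
  by rewrite qpoch_pm t2; congr qpoch; ring.
have Et : (q * q ^+ 2 / t) ^+ 2 = q ^+ 3 / a.
  by rewrite exprMn exprVn t2; field; rewrite a0 q0.
have Er : (q * q ^+ 2 / r) ^+ 2 = q ^+ 3 / a * q ^+ 2.
  by rewrite exprMn exprVn r2; field; rewrite a0 q0.
have -> : qpoch (q ^+ 3 / a) ((q ^+ 2) ^+ 2) n
    = qpoch (q * q ^+ 2 / t) (q ^+ 2) n * qpoch (- (q * q ^+ 2 / t)) (q ^+ 2) n.
  by rewrite qpoch_pm Et.
have -> : qpoch (q ^+ 3 / a * q ^+ 2) ((q ^+ 2) ^+ 2) n
    = qpoch (q * q ^+ 2 / r) (q ^+ 2) n * qpoch (- (q * q ^+ 2 / r)) (q ^+ 2) n.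
  by rewrite qpoch_pm Er.
have -> : q ^+ (2 * n.*2).+1 = q * (q ^+ 2) ^+ (2 * n).
  by rewrite exprS -mul2n exprM.
have -> : (- a) ^+ n.*2 = (a ^+ 2) ^+ n by rewrite -mul2n exprM sqrrN.
have := qpoch_neq0 q2n n; have := qpoch_neq0 qq2n n.
move: ((a ^+ 2) ^+ n) => y.
by field_atoms.
Qed.

(** For odd indices the first factor of each symbol is split off; these factors
    form the coefficient of the second series. *)
Lemma W_term2 n :
  let s := [:: q ^+ 3 / (a * b); q ^+ 4 / (a * b); b * q; b * q ^+ 2;
         sqrtC (q ^+ 3 * a); - sqrtC (q ^+ 3 * a);
         sqrtC (q ^+ 5 * a); - sqrtC (q ^+ 5 * a);
         q ^+ 3 / (a * d); q ^+ 2 * d / a; q ^+ 2] in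
  no_zero_factor (W_den (q ^+ 3) s (q ^+ 2)) (q ^+ 2) ->
  a ^+ 2
  * ((1 - q ^+ 3) * (1 - q ^+ 2 / (a * b)) * (1 - b) * (1 - a * q)
      * (1 - q / (a * d)) * (1 - d / a)
      / ((1 - q) * (1 - q ^+ 2 / b) * (1 - a * b) * (1 - a * d)
         * (1 - q ^+ 3 / a) * (1 - a * q / d)))
  * W_term (q ^+ 3) s (q ^+ 2) (a ^+ 2) n
  = bailey_delta q a b n.*2.+1 * sum_alpha n.*2.+1.
Proof.
move=> s h; rewrite W_termE // /sum_alpha wp_sum_odd //.
rewrite /s /= !qpochs_cons !qpochs_nil /bailey_delta !qpochSl !qpoch_split.
have sq5a0 : sqrtC (q ^+ 5 * a) != 0 by rewrite sqrtC_eq0 mulf_neq0 ?expf_neq0.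
have sq3a0 : sqrtC (q ^+ 3 * a) != 0 by rewrite sqrtC_eq0 mulf_neq0 ?expf_neq0.
have -> : q ^+ 3 * q ^+ 2 / (q ^+ 3 / (a * b)) = a * b * q * q by field; rewrite ?q0 ?a0 ?b0.
have -> : q ^+ 3 * q ^+ 2 / (q ^+ 4 / (a * b)) = a * b * q by field; rewrite ?q0 ?a0 ?b0.
have -> : q ^+ 3 * q ^+ 2 / (b * q) = q ^+ 2 / b * q * q by field; rewrite ?q0 ?a0 ?b0.
have -> : q ^+ 3 * q ^+ 2 / (b * q ^+ 2) = q ^+ 2 / b * q by field; rewrite ?q0 ?a0 ?b0.
have -> : q ^+ 3 * q ^+ 2 / (q ^+ 3 / (a * d)) = a * d * q ^+ 2 by field; rewrite ?q0 ?a0 ?d0.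
have -> : q ^+ 3 * q ^+ 2 / (q ^+ 2 * d / a) = a * q / d * q ^+ 2 by field; rewrite ?q0 ?a0 ?d0.
have -> : q ^+ 3 * q ^+ 2 / (q ^+ 2) = q ^+ 3 by field.
have -> : q ^+ 3 / (a * b) = q ^+ 2 / (a * b) * q by ring.
have -> : q ^+ 4 / (a * b) = q ^+ 2 / (a * b) * q * q by ring.
have -> : b * q ^+ 2 = b * q * q by ring.
have -> : q ^+ 3 / (a * d) = q / (a * d) * q ^+ 2 by ring.
have -> : q ^+ 2 * d / a = d / a * q ^+ 2 by ring.
have -> : a * q = q * a by ring.
rewrite !invrN !mulrN.
set r := sqrtC (q ^+ 3 * a); set t := sqrtC (q ^+ 5 * a).
have r2 : r ^+ 2 = q ^+ 3 * a by rewrite sqrtCK.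
have t2 : t ^+ 2 = q ^+ 5 * a by rewrite sqrtCK.
have -> : qpoch (q * a * q ^+ 2) ((q ^+ 2) ^+ 2) n
    = qpoch r (q ^+ 2) n * qpoch (- r) (q ^+ 2) n.
  by rewrite qpoch_pm r2; congr qpoch; ring.
have -> : qpoch (q * a * q ^+ 2 * q ^+ 2) ((q ^+ 2) ^+ 2) n
    = qpoch t (q ^+ 2) n * qpoch (- t) (q ^+ 2) n.
  by rewrite qpoch_pm t2; congr qpoch; ring.
have Et : (q ^+ 3 * q ^+ 2 / t) ^+ 2 = q ^+ 3 / a * q ^+ 2.
  by rewrite exprMn exprVn t2; field; rewrite a0 q0.
have Er : (q ^+ 3 * q ^+ 2 / r) ^+ 2 = q ^+ 3 / a * q ^+ 2 * q ^+ 2.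
  by rewrite exprMn exprVn r2; field; rewrite a0 q0.
have -> : qpoch (q ^+ 3 / a * q ^+ 2) ((q ^+ 2) ^+ 2) n
    = qpoch (q ^+ 3 * q ^+ 2 / t) (q ^+ 2) n * qpoch (- (q ^+ 3 * q ^+ 2 / t)) (q ^+ 2) n.
  by rewrite qpoch_pm Et.
have -> : qpoch (q ^+ 3 / a * q ^+ 2 * q ^+ 2) ((q ^+ 2) ^+ 2) n
    = qpoch (q ^+ 3 * q ^+ 2 / r) (q ^+ 2) n * qpoch (- (q ^+ 3 * q ^+ 2 / r)) (q ^+ 2) n.
  by rewrite qpoch_pm Er.
have -> : q ^+ (2 * n.*2.+1).+1 = q ^+ 3 * (q ^+ 2) ^+ (2 * n).
  by rewrite mulnS -addSn exprD -mul2n exprM.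
have -> : (- a) ^+ n.*2.+1 = - a * (a ^+ 2) ^+ n by rewrite exprS -mul2n exprM sqrrN.
have := qpoch_neq0 q2n n; have := qpoch_neq0 q3q2n n.
have : 1 - q ^+ 3 != 0 by have := q3q2n 0%N; rewrite expr0 mulr1.
move: ((a ^+ 2) ^+ n) => y.
by field_atoms.
Qed.

Hypotheses (cmp : comparison_test C) (gn : geometric_null C).

Lemma W_term3 n :
  let s := [:: q ^+ 2 / (a * b); b; a * q; - a; - (a * q);
         d; d * q; q / d; q ^+ 2 / d] in
  no_zero_factor (W_den a s (q ^+ 2)) (q ^+ 2) ->
  qpochs_inf [:: a ^+ 2 * b; b * q; q ^+ 3 / (a * b); q ^+ 2 * a / b] (q ^+ 2)
  * W_term a s (q ^+ 2) (a ^+ 2) n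
  = wp_alpha q a d n.*2 * a ^+ n.*2 * bailey_gamma q a b n.*2.
Proof.
move=> s h; have e1 : a * q ^+ 2 / (q ^+ 2 / (a * b)) = a ^+ 2 * b.
  by field; rewrite ?q0 ?a0 ?b0.
have e2 : a * q ^+ 2 / b = q ^+ 2 * a / b by ring.
have h1 : nonvanishing (a ^+ 2 * b) (q ^+ 2).
  by apply: h; rewrite -e1 !inE eqxx !orbT.
have h2 : nonvanishing (q ^+ 2 * a / b) (q ^+ 2).
  by apply: h; rewrite -e2 !inE eqxx !orbT.
rewrite W_termE // /qpochs_inf !big_cons big_nil.
rewrite /s /= !qpochs_cons !qpochs_nil e1 e2 {s h e1 e2}.
have -> : a * q ^+ 2 / (a * q) = q by field; rewrite ?q0 ?a0.
have -> : a * q ^+ 2 / - a = - q * q by field; rewrite ?oppr_eq0 ?q0 ?a0.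
have -> : a * q ^+ 2 / - (a * q) = - q by field; rewrite ?oppr_eq0 ?mulf_neq0 ?q0 ?a0.
have -> : a * q ^+ 2 / (d * q) = a * q / d by field; rewrite ?q0 ?d0.
have -> : a * q ^+ 2 / d = a * q / d * q by ring.
have -> : a * q ^+ 2 / (q / d) = a * d * q by field; rewrite ?q0 ?d0.
have -> : a * q ^+ 2 / (q ^+ 2 / d) = a * d by field; rewrite ?q0 ?d0.
have -> : q ^+ 2 / d = q / d * q by ring.
have -> : - (a * q) = - a * q by ring.
rewrite /wp_alpha /bailey_gamma.
have E : q ^+ n.*2 = (q ^+ 2) ^+ n by rewrite -mul2n exprM.
have -> : b * q ^+ n.*2.+1 = b * q * (q ^+ 2) ^+ n by rewrite exprS E mulrA.
have -> : q ^+ (n.*2 + 3) / (a * b) = q ^+ 3 / (a * b) * (q ^+ 2) ^+ n.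
  by rewrite addnC exprD E mulrAC.
have -> : a * q ^+ (n.*2 + 2) / b = q ^+ 2 * a / b * (q ^+ 2) ^+ n.
  by rewrite addnC exprD E; ring.
rewrite E.
rewrite (qpoch_infD cmp gn _ q2 (a ^+ 2 * b) n) (qpoch_infD cmp gn _ q2 (b * q) n).
rewrite (qpoch_infD cmp gn _ q2 (q ^+ 3 / (a * b)) n) (qpoch_infD cmp gn _ q2 (q ^+ 2 * a / b) n).
rewrite -(qpoch_pm a q n.*2) -(qpoch_pm q q n.*2) !qpoch_split.
have -> : q ^+ 3 / (a * b) = q ^+ 2 / (a * b) * q by ring.
have -> : q ^+ (2 * n.*2) = (q ^+ 2) ^+ (2 * n) by rewrite -mul2n exprM.
have -> : a ^+ n.*2 = (a ^+ 2) ^+ n by rewrite -mul2n exprM.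
rewrite -expr2.
have := qpoch_neq0 qq2n n; have := qpoch_neq0 q2n n.
have := qpoch_neq0 h1 n; have := qpoch_neq0 h2 n.
move: ((a ^+ 2) ^+ n) => y.
by field_atoms.
Qed.

Lemma W_term4 n :
  let s := [:: q ^+ 3 / (a * b); b * q; a * q; - (a * q); - (a * q ^+ 2);
          d * q; d * q ^+ 2; q ^+ 2 / d; q ^+ 3 / d] in
  no_zero_factor (W_den (a * q ^+ 2) s (q ^+ 2)) (q ^+ 2) ->
  a * ((1 - a * q ^+ 2) * (1 - d) * (1 - q / d) * (1 + a)
         / ((1 - q ^+ 2) * (1 - a * q / d) * (1 - a * d)))
  * qpochs_inf [:: q * a ^+ 2 * b; b; q ^+ 2 / (a * b); q ^+ 3 * a / b] (q ^+ 2)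
  * W_term (a * q ^+ 2) s (q ^+ 2) (a ^+ 2) n
  = wp_alpha q a d n.*2.+1 * a ^+ n.*2.+1 * bailey_gamma q a b n.*2.+1.
Proof.
move=> s h; have e1 : a * q ^+ 2 * q ^+ 2 / (q ^+ 3 / (a * b)) = q * a ^+ 2 * b.
  by field; rewrite ?q0 ?a0 ?b0.
have e2 : a * q ^+ 2 * q ^+ 2 / (b * q) = q ^+ 3 * a / b by field; rewrite ?q0 ?b0.
have h1 : nonvanishing (q * a ^+ 2 * b) (q ^+ 2).
  by apply: h; rewrite -e1 !inE eqxx !orbT.
have h2 : nonvanishing (q ^+ 3 * a / b) (q ^+ 2).
  by apply: h; rewrite -e2 !inE eqxx !orbT.
rewrite W_termE // /qpochs_inf !big_cons big_nil.
rewrite /s /= !qpochs_cons !qpochs_nil e1 e2 {s h e1 e2}.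
have -> : a * q ^+ 2 * q ^+ 2 / (a * q) = q ^+ 2 * q by field; rewrite ?q0 ?a0.
have -> : a * q ^+ 2 * q ^+ 2 / - (a * q) = - q ^+ 2 * q.
  by field; rewrite ?oppr_eq0 ?mulf_neq0 ?q0 ?a0.
have -> : a * q ^+ 2 * q ^+ 2 / - (a * q ^+ 2) = - q ^+ 2.
  by field; rewrite ?oppr_eq0 ?mulf_neq0 ?q0 ?a0 ?expf_neq0.
have -> : a * q ^+ 2 * q ^+ 2 / (d * q ^+ 2) = a * q / d * q by field; rewrite ?q0 ?d0.
have -> : a * q ^+ 2 * q ^+ 2 / (d * q) = a * q / d * q * q by field; rewrite ?q0 ?d0.
have -> : a * q ^+ 2 * q ^+ 2 / (q ^+ 2 / d) = a * d * q * q by field; rewrite ?q0 ?d0.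
have -> : a * q ^+ 2 * q ^+ 2 / (q ^+ 3 / d) = a * d * q by field; rewrite ?q0 ?d0.
have -> : q ^+ 2 / d = q / d * q by ring.
have -> : q ^+ 3 / d = q / d * q * q by ring.
have -> : - (a * q ^+ 2) = - (a * q) * q by ring.
have -> : 1 + - (a * q) * q = 1 - a * q ^+ 2 by ring.
have -> : d * q ^+ 2 = d * q * q by ring.
rewrite /wp_alpha /bailey_gamma.
have E : q ^+ n.*2 = (q ^+ 2) ^+ n by rewrite -mul2n exprM.
have -> : b * q ^+ n.*2.+2 = b * (q ^+ 2) ^+ n.+1 by rewrite -exprM mul2n.
have -> : q ^+ (n.*2.+1 + 3) / (a * b) = q ^+ 2 / (a * b) * (q ^+ 2) ^+ n.+1.
  rewrite (_ : n.*2.+1 + 3 = 2 + n.+1.*2)%N; last by lia.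
  by rewrite exprD -mul2n exprM mulrAC.
have -> : a * q ^+ (n.*2.+1 + 2) / b = q ^+ 3 * a / b * (q ^+ 2) ^+ n.
  rewrite (_ : n.*2.+1 + 2 = 3 + n.*2)%N; last by lia.
  by rewrite exprD E; ring.
have -> : a ^+ 2 * b * q ^+ n.*2.+1 = q * a ^+ 2 * b * (q ^+ 2) ^+ n.
  by rewrite (exprS q n.*2) E; ring.
rewrite (qpoch_infD cmp gn _ q2 (q * a ^+ 2 * b) n) (qpoch_infD cmp gn _ q2 b n.+1).
rewrite (qpoch_infD cmp gn _ q2 (q ^+ 2 / (a * b)) n.+1) (qpoch_infD cmp gn _ q2 (q ^+ 3 * a / b) n).
rewrite !(qpochS _ (q ^+ 2) n) (qpochS b q n.*2) (qpochS (_ / (a * b)) q n.*2) E.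
rewrite !qpochSl -(exprMn 2 a q) -(exprD q 2 2) (exprM q 2 2).
rewrite -(qpoch_pm (a * q) q n.*2) -(qpoch_pm (q ^+ 2) q n.*2) !qpoch_split.
have -> : q ^+ 3 / (a * b) = q ^+ 2 / (a * b) * q by ring.
have -> : a * q ^+ (2 * n.*2.+1) = a * q ^+ 2 * (q ^+ 2) ^+ (2 * n).
  by rewrite mulnS exprD -mul2n exprM mulrA.
have -> : a ^+ n.*2.+1 = a * (a ^+ 2) ^+ n by rewrite exprS -mul2n exprM.
have -> : 1 - a ^+ 2 = (1 - a) * (1 + a) by ring.
have -> : a * q * q = a * q ^+ 2 by ring.
have q3n : nonvanishing (q ^+ 2 * q) (q ^+ 2) by rewrite -exprSr.
have := qpoch_neq0 q3n n; have := qpoch_neq0 q2n n.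
have := qpoch_neq0 h1 n; have := qpoch_neq0 h2 n.
have : 1 - a != 0 by have := an 0%N; rewrite expr0 mulr1.
have : 1 - a * q ^+ 2 != 0 by exact: an.
move: ((a ^+ 2) ^+ n) => y.
by field_atoms.
Qed.

End Terms.

(** * Termination when |a| >= 1 *)

Lemma W_den_mem {C : numClosedFieldType} (a1 : C) (s : seq C) (p y : C) :
  y \in s -> a1 * p / y \in W_den a1 s p.
Proof.
by move=> ys; rewrite /W_den !in_cons (map_f (fun z => a1 * p / z) ys) !orbT.
Qed.

Section Transformation.
Context {C : numClosedFieldType}.
Hypotheses (cmp : comparison_test C) (gn : geometric_null C).
Variables (q a b d : C).
Hypotheses (q0 : q != 0) (a0 : a != 0) (b0 : b != 0) (d0 : d != 0).
Hypothesis q1 : `|q| < 1.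

Let s1 := [:: q ^+ 2 / (a * b); q ^+ 3 / (a * b); b; b * q;
         sqrtC (q * a); - sqrtC (q * a);
         sqrtC (q ^+ 3 * a); - sqrtC (q ^+ 3 * a);
         q ^+ 2 / (a * d); q * d / a; q ^+ 2].
Let s2 := [:: q ^+ 3 / (a * b); q ^+ 4 / (a * b); b * q; b * q ^+ 2;
         sqrtC (q ^+ 3 * a); - sqrtC (q ^+ 3 * a);
         sqrtC (q ^+ 5 * a); - sqrtC (q ^+ 5 * a);
         q ^+ 3 / (a * d); q ^+ 2 * d / a; q ^+ 2].
Let s3 := [:: q ^+ 2 / (a * b); b; a * q; - a; - (a * q);
         d; d * q; q / d; q ^+ 2 / d].
Let s4 := [:: q ^+ 3 / (a * b); b * q; a * q; - (a * q); - (a * q ^+ 2);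
          d * q; d * q ^+ 2; q ^+ 2 / d; q ^+ 3 / d].

Hypothesis an : nonvanishing a q.
Hypotheses (adm1 : W_admissible q s1 (q ^+ 2) (a ^+ 2))
  (adm2 : W_admissible (q ^+ 3) s2 (q ^+ 2) (a ^+ 2))
  (adm3 : W_admissible a s3 (q ^+ 2) (a ^+ 2))
  (adm4 : W_admissible (a * q ^+ 2) s4 (q ^+ 2) (a ^+ 2)).

Let q2 : `|q ^+ 2| < 1. Proof. by rewrite normrX expr_lt1. Qed.
Let qn : nonvanishing q q. Proof. exact: nonvanishing_small. Qed.

Lemma nonvanishing_merge (x : C) :
  nonvanishing x (q ^+ 2) -> nonvanishing (x * q) (q ^+ 2) -> nonvanishing x q.
Proof.
move=> h0 h1 j; rewrite -(odd_double_half j) exprD -mul2n exprM mulrA.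
by case: (odd j); rewrite ?expr1 ?expr0 ?mulr1.
Qed.

Let den_first y : y \in s1 -> nonvanishing (q * q ^+ 2 / y) (q ^+ 2).
Proof.
by move=> ys; apply: (proj1 adm1); exact: W_den_mem.
Qed.

Let den_third y : y \in s3 -> nonvanishing (a * q ^+ 2 / y) (q ^+ 2).
Proof.
by move=> ys; apply: (proj1 adm3); exact: W_den_mem.
Qed.

Let abn : nonvanishing (a * b) q.
Proof.
apply: nonvanishing_merge.
  rewrite (_ : a * b = q * q ^+ 2 / (q ^+ 3 / (a * b))); last by field; rewrite ?q0 ?a0 ?b0.
  by apply: den_first; rewrite ?/s1 ?/s3 !inE eqxx ?orbT.
rewrite (_ : a * b * q = q * q ^+ 2 / (q ^+ 2 / (a * b))); last by field; rewrite ?q0 ?a0 ?b0.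
by apply: den_first; rewrite ?/s1 ?/s3 !inE eqxx ?orbT.
Qed.

Let qbn : nonvanishing (q ^+ 2 / b) q.
Proof.
apply: nonvanishing_merge.
  rewrite (_ : q ^+ 2 / b = q * q ^+ 2 / (b * q)); last by field; rewrite ?q0 ?a0 ?b0.
  by apply: den_first; rewrite ?/s1 ?/s3 !inE eqxx ?orbT.
rewrite (_ : q ^+ 2 / b * q = q * q ^+ 2 / b); last by ring.
by apply: den_first; rewrite ?/s1 ?/s3 !inE eqxx ?orbT.
Qed.

Let sqr_factor_neq0 (u v : C) j : u ^+ 2 = v -> 1 - u * (q ^+ 2) ^+ j != 0 ->
  1 - - u * (q ^+ 2) ^+ j != 0 -> 1 - v * (q ^+ 2) ^+ (2 * j) != 0.
Proof.
move=> <- h1 h2; rewrite (mulnC 2) exprM.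
rewrite (_ : _ - _ = (1 - u * (q ^+ 2) ^+ j) * (1 - - u * (q ^+ 2) ^+ j)); last by ring.
exact: mulf_neq0.
Qed.

Let qan : nonvanishing (q ^+ 3 / a) (q ^+ 2).
Proof.
have sq k : sqrtC (q ^+ k * a) \in s1 -> - sqrtC (q ^+ k * a) \in s1 -> forall j,
   1 - (q ^+ 6 / (q ^+ k * a)) * (q ^+ 2) ^+ (2 * j) != 0.
  move=> h1 h2 j; apply: (sqr_factor_neq0 (q * q ^+ 2 / sqrtC (q ^+ k * a))).
  - by rewrite exprMn exprVn sqrtCK; congr (_ / _); ring.
  - exact: den_first.
  - by have := den_first _ h2 j; rewrite invrN mulrN.
move=> j; rewrite -(odd_double_half j) addnC exprD -mul2n mulrA mulrAC.
case: (odd j); rewrite ?expr1 ?expr0 ?mulr1.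
  have := sq 1%N _ _ j./2; rewrite expr1.
  rewrite (_ : q ^+ 6 / (q * a) = q ^+ 3 / a * q ^+ 2); last by field; rewrite ?q0 ?a0.
  by apply; rewrite ?/s1 ?/s3 !inE eqxx ?orbT.
have := sq 3%N _ _ j./2.
rewrite (_ : q ^+ 6 / (q ^+ 3 * a) = q ^+ 3 / a); last by field; rewrite ?q0 ?a0.
by apply; rewrite ?/s1 ?/s3 !inE eqxx ?orbT.
Qed.

Let adn : nonvanishing (a * d) q.
Proof.
apply: nonvanishing_merge.
  rewrite (_ : a * d = a * q ^+ 2 / (q ^+ 2 / d)); last by field; rewrite ?q0 ?a0 ?d0.
  by apply: den_third; rewrite ?/s1 ?/s3 !inE eqxx ?orbT.
rewrite (_ : a * d * q = a * q ^+ 2 / (q / d)); last by field; rewrite ?q0 ?a0 ?d0.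
by apply: den_third; rewrite ?/s1 ?/s3 !inE eqxx ?orbT.
Qed.

Let aqdn : nonvanishing (a * q / d) q.
Proof.
apply: nonvanishing_merge.
  rewrite (_ : a * q / d = a * q ^+ 2 / (d * q)); last by field; rewrite ?q0 ?a0 ?d0.
  by apply: den_third; rewrite ?/s1 ?/s3 !inE eqxx ?orbT.
rewrite (_ : a * q / d * q = a * q ^+ 2 / d); last by field; rewrite ?q0 ?a0 ?d0.
by apply: den_third; rewrite ?/s1 ?/s3 !inE eqxx ?orbT.
Qed.

(** Since no a q^k with k >= 0 equals 1, the number a can only be a power of q
    with positive exponent. *)
Lemma power_ratio_small i j : a * q ^+ i = q ^+ j -> `|a| < 1.
Proof.
move=> e; have [ij|ji] := ltnP i j.
  have -> : a = q ^+ (j - i).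
    apply: (mulIf (expf_neq0 i q0)); by rewrite e -exprD subnK // ltnW.
  by rewrite normrX exprn_ilt1 // -lt0n subn_gt0.
have : a * q ^+ (i - j) = 1.
  by apply: (mulIf (expf_neq0 j q0)); rewrite -mulrA -exprD subnK // e mul1r.
by move=> e1; have := an (i - j)%N; rewrite e1 subrr eqxx.
Qed.

Let small_power_neq1 (y : C) (j : nat) : `|y| < 1 -> y * (q ^+ 2) ^+ j = 1 -> False.
Proof.
by move=> y1 e; have := nonvanishing_small _ _ y1 q2 j; rewrite e subrr eqxx.
Qed.

Let a_power_neq1 (i j : nat) : a * q ^+ i * (q ^+ 2) ^+ j = 1 -> False.
Proof.
by move=> e; have := an (i + 2 * j)%N; rewrite exprD exprM mulrA e subrr eqxx.
Qed.

Let sqr_power_eq1 (y z : C) (j : nat) : z ^+ 2 = y -> z * (q ^+ 2) ^+ j = 1 ->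
  y * (q ^+ 2) ^+ (2 * j) = 1.
Proof. by move=> <- e; rewrite mulnC exprM -exprMn e expr1n. Qed.

(** A numerator parameter of the first series must be q^(-2j).  The parameters
    that are powers of q are excluded by |q| < 1, and the square roots of q a and
    q^3 a because no a q^k equals 1. *)
Lemma first_series_stops : ~~ (`|a| < 1) ->
  (exists l, b * q ^+ l = 1 \/ q ^+ 2 / (a * b) * q ^+ l = 1)
  \/ (exists j, a * d = q ^+ (2 * j).+2) \/ (exists j, a = d * q ^+ (2 * j).+1).
Proof.
move=> a1; have a21 : ~~ (`|a ^+ 2| < 1) by rewrite normrX expr_lt1.
have E j : (q ^+ 2) ^+ j = q ^+ (2 * j) by rewrite exprM.
have [y ys [j e]] := W_terminates gn _ _ _ _ q2 a21 adm1.
have q5 : `|q ^+ 4 * q| < 1 by rewrite -exprSr normrX expr_lt1.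
have vwp z : z ^+ 2 = q ^+ 4 * q -> y = z -> False.
  by move=> hz yz; apply: (small_power_neq1 _ _ q5 (sqr_power_eq1 _ _ j hz _)); rewrite -yz.
have sq1 z : z ^+ 2 = q * a -> y = z -> False.
  move=> hz yz; rewrite yz in e; apply: (a_power_neq1 1 (2 * j)).
  by rewrite expr1 (mulrC a); exact: sqr_power_eq1 e.
have sq3 z : z ^+ 2 = q ^+ 3 * a -> y = z -> False.
  move=> hz yz; rewrite yz in e; apply: (a_power_neq1 3 (2 * j)).
  by rewrite (mulrC a); exact: sqr_power_eq1 e.
move: ys; rewrite W_numE /s1 !inE => /or4P[/eqP yE|/eqP/vwp[]|/eqP/vwp[]|].
- by rewrite yE in e; case: (small_power_neq1 _ _ q1 e).
- by rewrite exprMn sqrtCK -exprM.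
- by rewrite sqrrN exprMn sqrtCK -exprM.
case/or4P=> [/eqP yE|/eqP yE|/eqP yE|].
- by left; exists (2 * j)%N; right; rewrite -E -yE.
- left; exists (2 * j).+1; right; rewrite -e yE (exprS q (2 * j)) -E; ring.
- by left; exists (2 * j)%N; left; rewrite -E -yE.
case/or4P=> [/eqP yE|/eqP/sq1[]|/eqP/sq1[]|].
- by left; exists (2 * j).+1; left; rewrite (exprS q (2 * j)) -E mulrA -yE.
- by rewrite sqrtCK.
- by rewrite sqrrN sqrtCK.
case/or4P=> [/eqP/sq3[]|/eqP/sq3[]|/eqP yE|/orP[/eqP yE|/eqP yE]].
- by rewrite sqrtCK.
- by rewrite sqrrN sqrtCK.
- right; left; exists j; apply/esym; rewrite -[RHS]mulr1 -e yE E (exprS q (2 * j).+1) (exprS q (2 * j)).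
  by field; rewrite ?a0 ?d0.
- right; right; exists j; rewrite -[LHS]mulr1 -e yE E (exprS q (2 * j)).
  by field; rewrite ?a0.
- by rewrite yE in e; case: (small_power_neq1 _ _ q2 e).
Qed.

Lemma third_series_stops : ~~ (`|a| < 1) ->
  (exists l, b * q ^+ l = 1 \/ q ^+ 2 / (a * b) * q ^+ l = 1)
  \/ [\/ exists m, - a * q ^+ m = 1, exists m, d * q ^+ m = 1
       | exists m, d = q ^+ m.+1].
Proof.
move=> a1; have a21 : ~~ (`|a ^+ 2| < 1) by rewrite normrX expr_lt1.
have E j : (q ^+ 2) ^+ j = q ^+ (2 * j) by rewrite exprM.
have [y ys [j e]] := W_terminates gn _ _ _ _ q2 a21 adm3.
have vwp z : z ^+ 2 = a * q ^+ 4 -> y = z -> False.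
  by move=> hz yz; rewrite yz in e; exact: (a_power_neq1 4 (2 * j) (sqr_power_eq1 _ _ j hz e)).
move: ys; rewrite W_numE /s3 !inE => /or4P[/eqP yE|/eqP/vwp[]|/eqP/vwp[]|].
- by rewrite yE -[a]mulr1 -(expr0 q) in e; case: (a_power_neq1 _ _ e).
- by rewrite exprMn sqrtCK -exprM mulrC.
- by rewrite sqrrN exprMn sqrtCK -exprM mulrC.
case/or4P=> [/eqP yE|/eqP yE|/eqP yE|].
- by left; exists (2 * j)%N; right; rewrite -E -yE.
- by left; exists (2 * j)%N; left; rewrite -E -yE.
- by rewrite yE -[q in a * q]expr1 in e; case: (a_power_neq1 _ _ e).
case/or4P=> [/eqP yE|/eqP yE|/eqP yE|].
- by right; apply: Or31; exists (2 * j)%N; rewrite -E -yE.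
- right; apply: Or31; exists (2 * j).+1; rewrite -e yE (exprS q (2 * j)) -E; ring.
- by right; apply: Or32; exists (2 * j)%N; rewrite -E -yE.
case/or3P=> /eqP yE.
- right; apply: Or32; exists (2 * j).+1; rewrite -e yE (exprS q (2 * j)) -E; ring.
- right; apply: Or33; exists (2 * j)%N; rewrite -[LHS]mulr1 -e yE E (exprS q (2 * j)).
  by field; rewrite ?d0.
- right; apply: Or33; exists (2 * j).+1; rewrite -[LHS]mulr1 -e yE E (exprS q (2 * j).+1) (exprS q (2 * j)).
  by field; rewrite ?d0.
Qed.

(** If neither b nor q^2/(ab) stops the series, then by the first series ad or
    a/d is a power of q, and by the third one so is -a or d.  A power of q for d
    makes a one as well, against [power_ratio_small]; one for -a makes a
    denominator of the first series vanish. *)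
Lemma small_or_terminating : `|a| < 1 \/
  exists l, b * q ^+ l = 1 \/ q ^+ 2 / (a * b) * q ^+ l = 1.
Proof.
have [a1|a1] := boolP (`|a| < 1); [by left|right].
have [//|h] := first_series_stops a1; have [//|h'] := third_series_stops a1.
have big i j : a * q ^+ i = q ^+ j -> False.
  by move=> /power_ratio_small; apply/negP.
have E j : (q ^+ 2) ^+ j = q ^+ (2 * j) by rewrite exprM.
exfalso; case: h => [[j adE]|[j aE]]; case: h' => [[m e]|[m e]|[m e]].
(* Here q^2 a/d, a denominator parameter, is q^(-2(m+j)). *)
- have := den_first (q * d / a); rewrite /s1 !inE eqxx ?orbT => /(_ isT) /(_ (m + j)%N).
  rewrite E mulnDr exprD (mulnC 2 m) exprM (_ : _ * _ = (- a * q ^+ m) ^+ 2).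
    by rewrite e expr1n subrr eqxx.
  transitivity (a * d * a / d * (q ^+ m) ^+ 2); last by field.
  by rewrite adE (exprS q (2 * j).+1) (exprS q (2 * j)); field; rewrite ?q0 ?a0 ?d0.
- apply: (big 0%N ((2 * j).+2 + m)%N).
  by rewrite expr0 exprD -adE -mulrA e.
- by apply: (big m.+1 (2 * j).+2); rewrite -e.
(* Here q a d, a denominator parameter, is q^(-2(m+j)). *)
- have := den_first (q ^+ 2 / (a * d)); rewrite /s1 !inE eqxx ?orbT => /(_ isT) /(_ (m + j)%N).
  rewrite E mulnDr exprD (mulnC 2 m) exprM (_ : _ * _ = (- a * q ^+ m) ^+ 2).
    by rewrite e expr1n subrr eqxx.
  transitivity (a * (d * q ^+ (2 * j).+1) * (q ^+ m) ^+ 2); last by rewrite -aE; ring.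
  by rewrite (exprS q (2 * j)); field; rewrite ?q0 ?a0 ?d0.
- by apply: (big m (2 * j).+1); rewrite aE mulrAC e mul1r.
- apply: (big 0%N (m.+1 + (2 * j).+1)%N).
  by rewrite expr0 mulr1 aE e -exprD.
Qed.

(** * The transformation *)

Let cvg_adm (a1 : C) s p x : W_admissible a1 s p x -> cvgn (series (W_term a1 s p x)).
Proof. by move=> [_ h]; apply: cmp h => n. Qed.

Theorem quadratic_transformation :
  qpochs_inf [:: a * b; q ^+ 2 / b] q
  * qpochs_inf [:: q; q ^+ 3 / a; q ^+ 2 * a; a ^+ 2] (q ^+ 2)
  / qpochs_inf [:: q ^+ 2; a] q
  * (W q s1 (q ^+ 2) (a ^+ 2)
     + a ^+ 2
       * ((1 - q ^+ 3) * (1 - q ^+ 2 / (a * b)) * (1 - b) * (1 - a * q)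
          * (1 - q / (a * d)) * (1 - d / a)
          / ((1 - q) * (1 - q ^+ 2 / b) * (1 - a * b) * (1 - a * d)
             * (1 - q ^+ 3 / a) * (1 - a * q / d)))
       * W (q ^+ 3) s2 (q ^+ 2) (a ^+ 2))
  = qpochs_inf [:: a ^+ 2 * b; b * q; q ^+ 3 / (a * b); q ^+ 2 * a / b] (q ^+ 2)
    * W a s3 (q ^+ 2) (a ^+ 2)
    + a
      * ((1 - a * q ^+ 2) * (1 - d) * (1 - q / d) * (1 + a)
         / ((1 - q ^+ 2) * (1 - a * q / d) * (1 - a * d)))
      * qpochs_inf [:: q * a ^+ 2 * b; b; q ^+ 2 / (a * b); q ^+ 3 * a / b]
          (q ^+ 2)
      * W (a * q ^+ 2) s4 (q ^+ 2) (a ^+ 2).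
Proof.
have -> : qpochs_inf [:: a * b; q ^+ 2 / b] q
  * qpochs_inf [:: q; q ^+ 3 / a; q ^+ 2 * a; a ^+ 2] (q ^+ 2)
  / qpochs_inf [:: q ^+ 2; a] q = bailey_prefactor q a b.
  rewrite /bailey_prefactor /qpochs_inf !big_cons !big_nil.
  repeat match goal with
    | |- context [qpoch_inf ?u ?v] => move: (qpoch_inf u v) => ? end.
  by rewrite !mulr1 !mulrA.
have [s hs hr] := bailey_sum cmp gn q a b d q0 a0 b0 q1 an abn qbn qan adn aqdn
  small_or_terminating.
have t1 n := W_term1 q a b d q0 a0 b0 d0 q1 an adn aqdn n (proj1 adm1).
have t2 n := W_term2 q a b d q0 a0 b0 d0 q1 an adn aqdn n (proj1 adm2).
have t3 n := W_term3 q a b d q0 a0 b0 d0 q1 cmp gn n (proj1 adm3).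
have t4 n := W_term4 q a b d q0 a0 b0 d0 q1 an cmp gn n (proj1 adm4).
have c1 := cvg_adm _ _ _ _ adm1; have c2 := cvg_adm _ _ _ _ adm2.
have c3 := cvg_adm _ _ _ _ adm3; have c4 := cvg_adm _ _ _ _ adm4.
have {}hs : series (fun N => bailey_delta q a b N
   * (\sum_(M < N.+1) wp_alpha q a d M * (-1) ^+ M * wp_kernel q a N M)) n
   @[n --> \oo] --> s.
  by apply: eq_cvgn hs _ => n; rewrite /series /= big_mkord.
have {}t1 n := etrans (mul1r _) (t1 n).
have sE := cvg_even_odd _ _ _ _ _ _ hs c1 c2 t1 t2.
have rE := cvg_even_odd _ _ _ _ _ _ hr c3 c4 t3 t4.
by rewrite mul1r in sE; rewrite /W -sE.
Qed.
End Transformation.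

Theorem corollary8 (R : realType) (q a b d : R[i])
  (q_neq0 : q != 0) (a_neq0 : a != 0) (b_neq0 : b != 0) (d_neq0 : d != 0)
  (q_lt1 : `|q| < 1)
  (den_prod : no_zero_factor [:: q ^+ 2; a] q)
  (den_left : [/\ 1 - q != 0, 1 - q ^+ 2 / b != 0 & 1 - a * b != 0] /\
              [/\ 1 - a * d != 0, 1 - q ^+ 3 / a != 0 & 1 - a * q / d != 0])
  (den_right : [/\ 1 - q ^+ 2 != 0, 1 - a * q / d != 0 & 1 - a * d != 0])
  (adm1 : W_admissible q
     [:: q ^+ 2 / (a * b); q ^+ 3 / (a * b); b; b * q;
         sqrtC (q * a); - sqrtC (q * a);
         sqrtC (q ^+ 3 * a); - sqrtC (q ^+ 3 * a);
         q ^+ 2 / (a * d); q * d / a; q ^+ 2] (q ^+ 2) (a ^+ 2))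
  (adm2 : W_admissible (q ^+ 3)
     [:: q ^+ 3 / (a * b); q ^+ 4 / (a * b); b * q; b * q ^+ 2;
         sqrtC (q ^+ 3 * a); - sqrtC (q ^+ 3 * a);
         sqrtC (q ^+ 5 * a); - sqrtC (q ^+ 5 * a);
         q ^+ 3 / (a * d); q ^+ 2 * d / a; q ^+ 2] (q ^+ 2) (a ^+ 2))
  (adm3 : W_admissible a
     [:: q ^+ 2 / (a * b); b; a * q; - a; - (a * q);
         d; d * q; q / d; q ^+ 2 / d] (q ^+ 2) (a ^+ 2))
  (adm4 : W_admissible (a * q ^+ 2)
     [:: q ^+ 3 / (a * b); b * q; a * q; - (a * q); - (a * q ^+ 2);
         d * q; d * q ^+ 2; q ^+ 2 / d; q ^+ 3 / d] (q ^+ 2) (a ^+ 2)) :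
  qpochs_inf [:: a * b; q ^+ 2 / b] q
  * qpochs_inf [:: q; q ^+ 3 / a; q ^+ 2 * a; a ^+ 2] (q ^+ 2)
  / qpochs_inf [:: q ^+ 2; a] q
  * (W q
       [:: q ^+ 2 / (a * b); q ^+ 3 / (a * b); b; b * q;
           sqrtC (q * a); - sqrtC (q * a);
           sqrtC (q ^+ 3 * a); - sqrtC (q ^+ 3 * a);
           q ^+ 2 / (a * d); q * d / a; q ^+ 2] (q ^+ 2) (a ^+ 2)
     + a ^+ 2
       * ((1 - q ^+ 3) * (1 - q ^+ 2 / (a * b)) * (1 - b) * (1 - a * q)
          * (1 - q / (a * d)) * (1 - d / a)
          / ((1 - q) * (1 - q ^+ 2 / b) * (1 - a * b) * (1 - a * d)
             * (1 - q ^+ 3 / a) * (1 - a * q / d)))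
       * W (q ^+ 3)
           [:: q ^+ 3 / (a * b); q ^+ 4 / (a * b); b * q; b * q ^+ 2;
               sqrtC (q ^+ 3 * a); - sqrtC (q ^+ 3 * a);
               sqrtC (q ^+ 5 * a); - sqrtC (q ^+ 5 * a);
               q ^+ 3 / (a * d); q ^+ 2 * d / a; q ^+ 2] (q ^+ 2) (a ^+ 2))
  = qpochs_inf [:: a ^+ 2 * b; b * q; q ^+ 3 / (a * b); q ^+ 2 * a / b] (q ^+ 2)
    * W a
        [:: q ^+ 2 / (a * b); b; a * q; - a; - (a * q);
            d; d * q; q / d; q ^+ 2 / d] (q ^+ 2) (a ^+ 2)
    + a
      * ((1 - a * q ^+ 2) * (1 - d) * (1 - q / d) * (1 + a)
         / ((1 - q ^+ 2) * (1 - a * q / d) * (1 - a * d)))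
      * qpochs_inf [:: q * a ^+ 2 * b; b; q ^+ 2 / (a * b); q ^+ 3 * a / b]
          (q ^+ 2)
      * W (a * q ^+ 2)
          [:: q ^+ 3 / (a * b); b * q; a * q; - (a * q); - (a * q ^+ 2);
              d * q; d * q ^+ 2; q ^+ 2 / d; q ^+ 3 / d] (q ^+ 2) (a ^+ 2).
Proof.
have an : nonvanishing a q by apply: den_prod; rewrite !inE eqxx orbT.
exact: (quadratic_transformation (@complex_comparison R) (@complex_geometric_null R)
  q a b d q_neq0 a_neq0 b_neq0 d_neq0 q_lt1 an adm1 adm2 adm3 adm4).
Qed.
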